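(* Let $\varphi$ be a convex nondecreasing function on $[0,\infty)$ with $\varphi(0)=0$ and $\varphi(uv)\le\varphi(u)\varphi(v)$ for $u,v\ge0$, such that $$Pf-Pf_*\ge\varphi\Big(\sqrt{\mathrm{Var}_P(f-f_* )}\Big)\quad\text{for all }f\in\mathcal{F}.$$ Let $\varepsilon>0$ be fixed. Let $\{t_k\}$ be any sequence of positive numbers and let $\hat\delta_n(\mathcal{F}_k;t_k)$ (data-dependent) and $\tilde\delta_n(\mathcal{F}_k;t_k)$ (distribution-dependent) satisfy $$\mathbb{P}\{\bar\delta_n(\mathcal{F}_k;t_k)\le\hat\delta_n(\mathcal{F}_k;t_k)\le\tilde\delta_n(\mathcal{F}_k;t_k)\}\ge1-p_k\quad\text{for all }k.$$ With $A(\varepsilon):=\frac52-\varphi(\sqrt\varepsilon)$ and $\varphi^*(v):=\sup_{u\ge0}[uv-\varphi(u)]$, define $$\hat\pi(k):=A(\varepsilon)\hat\delta_n(\mathcal{F}_k;t_k)+\varphi^*\left(\sqrt{\frac{2t_k}{\varepsilon n}}\right)+\frac{t_k}n,$$ $$\tilde\pi(k):=\frac{A(\varepsilon)}{1+\varphi(\sqrt\varepsilon)}\tilde\delta_n(\mathcal{F}_k;t_k)+\frac2{1+\varphi(\sqrt\varepsilon)}\varphi^*\left(\sqrt{\frac{2t_k}{\varepsilon n}}\right)+\frac2{1+\varphi(\sqrt\varepsilon)}\frac{t_k}n,$$ $\hat k:=\operatorname{argmin}_{k\ge1}\{P_n\hat f_{n,k}+\hat\pi(k)\}$ and $\hat f:=\hat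 f_{n,\hat k}$. Then $$\mathbb{P}\Big\{\mathcal{E}_P(\mathcal{F};\hat f)\ge C(\varepsilon)\inf_{k\ge1}\Big\{\inf_{f\in\mathcal{F}_k}Pf-\inf_{f\in\mathcal{F}}Pf+\tilde\pi(k)\Big\}\Big\}\le\sum_{k=1}^\infty\left(p_k+2\log_q\frac{q^2n}{t_k}e^{-t_k}\right),$$ where $C(\varepsilon):=\frac{1+\varphi(\sqrt\varepsilon)}{1-\varphi(\sqrt\varepsilon)}$.
   Context: $(S,\mathcal{A},P)$ is a probability space, $\mathcal{F}$ is a class of measurable functions $f:S\to[0,1]$, $\mathcal{F}_k\subset\mathcal{F}$, $k\ge1$, are subclasses, $f_*:=\operatorname{argmin}_{f\in\mathcal{F}}Pf$ (assumed to exist), $X_1,\dots,X_n$ are i.i.d. with distribution $P$, $P_n$ is the empirical measure. $\mathrm{Var}_P(f):=Pf^2-(Pf)^2$; $\mathcal{E}_P(\mathcal{F};f):=Pf-\inf_{g\in\mathcal{F}}Pg$. $\hat f_{n,k}$ is a minimizer of $P_nf$ over $\mathcal{F}_k$ (assumed to exist). $q>1$ is fixed, $\delta_j:=q^{-j}$, $j\in\mathbb{Z}$; for $\psi:\mathbb{R}_+\to\mathbb{R}_+$, $\psi^{\flat,q}(\delta):=\sup_{j:\,\delta_j\ge\delta}\psi(\delta_j)/\delta_j$ and $\psi^{\sharp,q}(\varepsilon):=\inf\{\delta>0:\psi^{\flat,q}(\delta)\le\varepsilon\}$. $\rho_P:L_2(P)\times L_2(P)\to[0,\infty)$ is a fixed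 function with $\rho_P^2(f,g)\ge P(f-g)^2-(P(f-g))^2$ (e.g. $\rho_P^2(f,g)=P(f-g)^2$). For $\mathcal{G}\subset\mathcal{F}$: $\mathcal{G}(\delta):=\{f\in\mathcal{G}:Pf-\inf_{g\in\mathcal{G}}Pg\le\delta\}$, $D_P(\mathcal{G};\delta):=\sup_{f,g\in\mathcal{G}(\delta)}\rho_P(f,g)$, $\phi_n(\mathcal{G};\delta):=\mathbb{E}\sup_{f,g\in\mathcal{G}(\delta)}|(P_n-P)(f-g)|$, $\bar U_{n,t}(\delta):=2\big(\phi_n(\mathcal{G};\delta)+D_P(\mathcal{G};\delta)\sqrt{t/n}+t/n\big)$ and $\bar\delta_n(\mathcal{G};t):=\bar U_{n,t}^{\sharp,q}(\frac1{2q^3})$.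
   Formalization: Assumes φ(√ε)<1 (else C(ε) is undefined or negative and the claim fails); log_q(q²n/t_k) is replaced by its positive part (the literal bound can be negative if t_k>q²n); standard measurability of the suprema over F_k(δ), of the data-dependent δ̂ and of the risk of f̂ is assumed. *)

(* Defs.v *)
From HB Require Import structures.
From mathcomp Require Import all_boot all_order all_algebra.
From mathcomp Require Import all_classical all_reals all_analysis.
From mathcomp Require Import measurable_realfun.

Set Implicit Arguments.
Unset Strict Implicit.
Unset Printing Implicit Defensive.

Import Order.TTheory GRing.Theory Num.Theory.
Import numFieldNormedType.Exports.

Local Open Scope classical_set_scope.
Local Open Scope ring_scope.

Definition mean d (S : measurableType d) (R : realType) (P : probability S R)
    (f : S -> R) : R :=
  \int[P]_x f x.

Definition Var d (S : measurableType d) (R : realType) (P : probability S R)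
    (f : S -> R) : R :=
  mean P (fun x => f x ^+ 2) - mean P f ^+ 2.

Definition inf_risk d (S : measurableType d) (R : realType)
    (P : probability S R) (G : set (S -> R)) : R :=
  inf [set mean P g | g in G].

Definition excess_risk d (S : measurableType d) (R : realType)
    (P : probability S R) (G : set (S -> R)) (f : S -> R) : R :=
  mean P f - inf_risk P G.

(* The delta-minimal set G(delta). *)
Definition min_set d (S : measurableType d) (R : realType)
    (P : probability S R) (G : set (S -> R)) (delta : R) : set (S -> R) :=
  [set f | G f /\ excess_risk P G f <= delta].

Definition emp_mean (S : Type) (R : realType) (n : nat) (x : n.-tuple S)
    (f : S -> R) : R :=
  n%:R^-1 * \sum_(i < n) f (tnth x i).

Definition sample d' (Omega : measurableType d') d (S : measurableType d)
    (R : realType) (Pr : probability Omega R) (n : nat)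
    (X : 'I_n -> {RV Pr >-> S}) (w : Omega) : n.-tuple S :=
  [tuple X i w | i < n].

(* The product rule for the full family gives it for every subfamily, by taking
   [B i] to be the whole space outside the subfamily. *)
Definition iid d' (Omega : measurableType d') d (S : measurableType d)
    (R : realType) (Pr : probability Omega R) (P : probability S R) (n : nat)
    (X : 'I_n -> {RV Pr >-> S}) : Prop :=
  (forall i (B : set S), measurable B -> distribution Pr (X i) B = P B) /\
  (forall B : 'I_n -> set S, (forall i, measurable (B i)) ->
    Pr [set w | forall i, B i (X i w)] =
      (\prod_(i < n) Pr (X i @^-1` B i))%E).

Definition diff_class (S : Type) (R : realType) (G : set (S -> R)) :
    set (S -> R) :=
  [set (fun x => f x - g x) | f in G & g in G].

(* The suprema of the weighted centered empirical process over [H] are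
   measurable functions of the sample (a P-measurable class).  The weights
   [e i = n^-1] give the supremum of |(P_n - P) h| over [H]. *)
Definition measurable_class d (S : measurableType d) (R : realType)
    (P : probability S R) (n : nat) (H : set (S -> R)) : Prop :=
  forall e : 'I_n -> R,
    measurable_fun [set: n.-tuple S] (fun x : n.-tuple S => ereal_sup
      [set `|\sum_(i < n) e i * (h (tnth x i) - mean P h)|%:E | h in H]).

(* Extended-real valued: nothing bounds [rho] on G(delta). *)
Definition D_P d (S : measurableType d) (R : realType) (P : probability S R)
    (rho : (S -> R) -> (S -> R) -> R) (G : set (S -> R)) (delta : R) : \bar R :=
  ereal_sup
    [set (rho f g)%:E | f in min_set P G delta & g in min_set P G delta].

Definition phi_n d' (Omega : measurableType d') d (S : measurableType d)
    (R : realType) (Pr : probability Omega R) (P : probability S R) (n : nat)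
    (X : 'I_n -> {RV Pr >-> S}) (G : set (S -> R)) (delta : R) : \bar R :=
  (\int[Pr]_w ereal_sup
     [set `|emp_mean (sample X w) h - mean P h|%:E
        | h in diff_class (min_set P G delta)])%E.

Definition U_bar d' (Omega : measurableType d') d (S : measurableType d)
    (R : realType) (Pr : probability Omega R) (P : probability S R) (n : nat)
    (X : 'I_n -> {RV Pr >-> S}) (rho : (S -> R) -> (S -> R) -> R)
    (G : set (S -> R)) (t delta : R) : \bar R :=
  (2%:E * (phi_n P X G delta
           + D_P P rho G delta * (Num.sqrt (t / n%:R))%:E
           + (t / n%:R)%:E))%E.

Definition delta_ (R : realType) (q : R) (j : int) : R := q ^ (- j).

Definition flat_tr (R : realType) (q : R) (psi : R -> \bar R) (delta : R) :
    \bar R :=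
  ereal_sup [set (psi (delta_ q j) * ((delta_ q j)^-1)%:E)%E
            | j in [set j : int | delta <= delta_ q j]].

(* +oo when no delta > 0 qualifies. *)
Definition sharp_tr (R : realType) (q : R) (psi : R -> \bar R) (eps : R) :
    \bar R :=
  ereal_inf [set delta%:E
            | delta in [set delta : R |
                0 < delta /\ (flat_tr q psi delta <= eps%:E)%E]].

Definition delta_bar d' (Omega : measurableType d') d (S : measurableType d)
    (R : realType) (Pr : probability Omega R) (P : probability S R) (n : nat)
    (X : 'I_n -> {RV Pr >-> S}) (rho : (S -> R) -> (S -> R) -> R) (q : R)
    (G : set (S -> R)) (t : R) : \bar R :=
  sharp_tr q (U_bar P X rho G t) (1 / (2 * q ^+ 3)).

(* Extended-real valued: the supremum is +oo for large v when phi has linear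
   growth. *)
Definition conjugate (R : realType) (phi : R -> R) (v : R) : \bar R :=
  ereal_sup [set (u * v - phi u)%:E | u in [set u : R | 0 <= u]].

Definition A_const (R : realType) (phi : R -> R) (eps : R) : R :=
  5 / 2 - phi (Num.sqrt eps).

Definition C_const (R : realType) (phi : R -> R) (eps : R) : R :=
  (1 + phi (Num.sqrt eps)) / (1 - phi (Num.sqrt eps)).

Definition pi_hat (R : realType) (phi : R -> R) (eps : R) (n : nat)
    (t dhat : R) : \bar R :=
  ((A_const phi eps * dhat)%:E
   + conjugate phi (Num.sqrt (2 * t / (eps * n%:R)))
   + (t / n%:R)%:E)%E.

Definition pi_tilde (R : realType) (phi : R -> R) (eps : R) (n : nat)
    (t dtilde : R) : \bar R :=
  ((A_const phi eps / (1 + phi (Num.sqrt eps)) * dtilde)%:E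
   + (2 / (1 + phi (Num.sqrt eps)))%:E
     * conjugate phi (Num.sqrt (2 * t / (eps * n%:R)))
   + (2 / (1 + phi (Num.sqrt eps)) * (t / n%:R))%:E)%E.

Definition logq (R : realType) (q x : R) : R := ln x / ln q.

(* Main.v *)
Require Import Defs.
From HB Require Import structures.
From mathcomp Require Import all_boot all_order all_algebra.
From mathcomp Require Import all_classical all_reals all_analysis.
From mathcomp Require Import measurable_realfun lra ring.

Import Order.TTheory GRing.Theory Num.Theory.
Import numFieldNormedType.Exports.

Local Open Scope classical_set_scope.
Local Open Scope ring_scope.

(* Write Z for the supremum of the empirical process over a class of centered
   functions bounded by 1, Z_i for the same supremum without the i-th point,
   and Y_i = Z - Z_i. Evaluating at a near-maximizer of Z_i, resp. of Z, shows
   that E_i Y_i^2 <= v + 2 E_i Y_i and sum_i Y_i <= Z, where E_i integrates the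
   i-th point out. Fed into the tensorized entropy of exp(l Z) this is a
   differential inequality for ln E exp(l Z), and integrating it (Herbst) gives
   Talagrand's inequality P (Z >= 4 (E Z + sqrt (n v t)) + 2 t) <= exp(-t). The
   constants are not Bousquet's, but they are good enough: below, the supremum
   over G(delta_j) only has to be at most delta_j / q^3, twice the level
   delta_j / (2 q^3) at which U_bar controls it.

   On the event where that holds for the finitely many levels 1 >= delta_j >=
   t/n compatible with U_bar, an empirical minimizer in G(delta_j) lies in
   G(delta_(j+1)), so that its excess risk is at most delta_bar; by the same
   bound a near-minimizer of the risk has empirical excess at most delta_bar.
   Combined with Bernstein's inequality for one near-minimizer of each F_k and
   with Young's inequality uv <= phi u + phi^* v for the variance term, this
   bounds the penalized empirical risk from both sides. *)

(** * Bounded measurable functions *)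

(** Two obstacles shape the final bookkeeping. The infimum of the risk over a class [F_ k] need not
    be attained, and the event of the theorem is closed, so its defining inequality has to be
    refuted strictly. Bernstein's inequality is therefore used at a level t' < t. With eta := (t -
    t') / (2 n), an eta-minimizer loses at most (1 + phi (sqrt eps)) eta <= 2 eta = t / n - t' / n,
    which the two levels differ by. The term t / n in the penalty of the selected index then stays
    untouched and supplies the strict gap. The summand t / n inside [U_bar] does double duty. A
    level with U_bar <= delta_j / (2 q^3) satisfies delta_j >= 4 q^3 t / n, so only levels j <=
    log_q (n / t) can be compatible; and delta_bar >= 4 t / n follows, so that a fraction of [dhat]
    can absorb every remaining term of order t / n. Measures on tuples enter only through their
    values on rectangles. Conditional means are thus plain integrals over one resampled coordinate,
    defined at every point, and no conditional expectation given a sigma-algebra is involved. *)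

Definition bounded_meas {d} {S : measurableType d} {R : realType}
    (f : S -> R) : Prop :=
  measurable_fun [set: S] f /\ exists M, forall x, `|f x| <= M.

Section bounded_meas.
Context {d} {S : measurableType d} {R : realType}.
Implicit Types (f g : S -> R).

Lemma bounded_meas_cst (c : R) : bounded_meas (fun _ : S => c).
Proof. by split; [exact: measurable_cst | exists `|c|]. Qed.

Lemma bounded_meas_indic (A : set S) : measurable A ->
  bounded_meas (\1_A : S -> R).
Proof.
by move=> mA; split; [exact: measurable_indic | exists 1 => x; rewrite indicE;
  case: (x \in A); rewrite ?normr1 ?normr0].
Qed.

Lemma bounded_measD f g :
  bounded_meas f -> bounded_meas g -> bounded_meas (fun x => f x + g x).
Proof.
move=> [mf [M fM]] [mg [N gN]]; split; first exact: measurable_funD.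
by exists (M + N) => x; rewrite (le_trans (ler_normD _ _))// lerD.
Qed.

Lemma bounded_measN f : bounded_meas f -> bounded_meas (fun x => - f x).
Proof.
move=> [mf [M fM]]; split; first exact: measurableT_comp.
by exists M => x; rewrite normrN.
Qed.

Lemma bounded_measB f g :
  bounded_meas f -> bounded_meas g -> bounded_meas (fun x => f x - g x).
Proof. by move=> bf /bounded_measN; exact: bounded_measD. Qed.

Lemma bounded_measM f g :
  bounded_meas f -> bounded_meas g -> bounded_meas (fun x => f x * g x).
Proof.
move=> [mf [M fM]] [mg [N gN]]; split; first exact: measurable_funM.
by exists (M * N) => x; rewrite normrM ler_pM.
Qed.

Lemma bounded_measZ (c : R) f :
  bounded_meas f -> bounded_meas (fun x => c * f x).
Proof. exact/bounded_measM/bounded_meas_cst. Qed.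

Lemma bounded_measX f : bounded_meas f -> bounded_meas (fun x => f x ^+ 2).
Proof. by move=> bf; under eq_fun do rewrite expr2; exact: bounded_measM. Qed.

Lemma bounded_meas_expR f :
  bounded_meas f -> bounded_meas (fun x => expR (f x)).
Proof.
move=> [mf [M fM]]; split; first exact: measurableT_comp.
exists (expR M) => x; rewrite ger0_norm ?expR_ge0// ler_expR.
exact: le_trans (ler_norm _) (fM x).
Qed.

Lemma bounded_meas_ln f (m : R) : 0 < m -> (forall x, m <= f x) ->
  bounded_meas f -> bounded_meas (fun x => ln (f x)).
Proof.
move=> m0 mf [mef [M fM]]; split; first exact: measurableT_comp.
exists (`|ln m| + `|ln M|) => x.
have fx0 : 0 < f x by exact: lt_le_trans (mf x).
have fxM : f x <= M by exact: le_trans (ler_norm _) (fM x).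
have l1 : ln m <= ln (f x) by rewrite ler_ln.
have l2 : ln (f x) <= ln M by rewrite ler_ln// posrE (lt_le_trans fx0).
have := ler_norm (- ln m); have := ler_norm (ln M); rewrite normrN.
have := normr_ge0 (ln m); have := normr_ge0 (ln M).
by rewrite ler_norml => *; apply/andP; split; lra.
Qed.

Lemma bounded_meas_sum (I : eqType) (r : seq I) (F : I -> S -> R) :
  {in r, forall i, bounded_meas (F i)} ->
  bounded_meas (fun x => \sum_(i <- r) F i x).
Proof.
elim: r => [|i r IH] bF.
  by under eq_fun do rewrite big_nil; exact: bounded_meas_cst.
under eq_fun do rewrite big_cons; apply: bounded_measD.
  by apply: bF; rewrite mem_head.
by apply: IH => j jr; apply: bF; rewrite inE jr orbT.
Qed.

Variable P : probability S R.

Lemma bounded_meas_integrable f :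
  bounded_meas f -> P.-integrable [set: S] (EFin \o f).
Proof.
move=> [mf [M fM]]; apply: measurable_bounded_integrable => //.
  by rewrite (le_lt_trans (probability_le1 P measurableT))// ltry.
exists M; split; first by rewrite num_real.
by move=> N MN x _ /=; rewrite (le_trans (fM x))// ltW.
Qed.
Hint Resolve bounded_meas_integrable : core.

Lemma mean_cst (c : R) : mean P (fun=> c) = c.
Proof. by rewrite /mean Rintegral_cst//= [X in fine X](probability_setT P)
  mulr1. Qed.

Lemma meanD f g : bounded_meas f -> bounded_meas g ->
  mean P (fun x => f x + g x) = mean P f + mean P g.
Proof. by move=> ? ?; rewrite /mean RintegralD//;
  exact: bounded_meas_integrable. Qed.

Lemma meanB f g : bounded_meas f -> bounded_meas g ->
  mean P (fun x => f x - g x) = mean P f - mean P g.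
Proof. by move=> ? ?; rewrite /mean RintegralB//;
  exact: bounded_meas_integrable. Qed.

Lemma meanZ (c : R) f : bounded_meas f ->
  mean P (fun x => c * f x) = c * mean P f.
Proof. by move=> ?; rewrite /mean RintegralZl//;
  exact: bounded_meas_integrable. Qed.

Lemma mean_le f g : bounded_meas f -> bounded_meas g ->
  (forall x, f x <= g x) -> mean P f <= mean P g.
Proof. by move=> ? ? fg; apply: le_Rintegral => //;
  exact: bounded_meas_integrable. Qed.

Lemma mean_sum (I : eqType) (r : seq I) (F : I -> S -> R) :
  {in r, forall i, bounded_meas (F i)} ->
  mean P (fun x => \sum_(i <- r) F i x) = \sum_(i <- r) mean P (F i).
Proof.
elim: r => [|i r IH] bF.
  by under eq_fun do rewrite big_nil; rewrite big_nil mean_cst.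
under eq_fun do rewrite big_cons; rewrite big_cons meanD//.
- by rewrite IH// => j jr; apply: bF; rewrite inE jr orbT.
- by apply: bF; rewrite mem_head.
- by apply: bounded_meas_sum => j jr; apply: bF; rewrite inE jr orbT.
Qed.

Lemma EFin_mean f : bounded_meas f ->
  ((mean P f)%:E = \int[P]_x (f x)%:E)%E.
Proof.
move=> bf; rewrite /mean /Rintegral fineK//.
exact: integrable_fin_num (bounded_meas_integrable _ bf).
Qed.

Lemma mean_norm f (M : R) : bounded_meas f -> (forall x, `|f x| <= M) ->
  `|mean P f| <= M.
Proof.
move=> bf fM; rewrite ler_norml; apply/andP; split.
  rewrite -(mean_cst (- M)); apply: mean_le => //;
    first exact: bounded_meas_cst.
  by move=> x; have := fM x; rewrite ler_norml => /andP[].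
rewrite -(mean_cst M); apply: mean_le => //; first exact: bounded_meas_cst.
by move=> x; exact: le_trans (ler_norm _) (fM x).
Qed.

Lemma Var_center f : bounded_meas f ->
  mean P (fun s => (f s - mean P f) ^+ 2) = Var P f.
Proof.
move=> bf.
have -> : (fun s => (f s - mean P f) ^+ 2) =
    fun s => f s ^+ 2 + (- (2 * mean P f) * f s + mean P f ^+ 2).
  by apply/funext => s; ring.
have b1 : bounded_meas (fun s => f s ^+ 2) by exact: bounded_measX.
have b2 : bounded_meas (fun s => - (2 * mean P f) * f s) by exact:
  bounded_measZ.
have b3 : bounded_meas (fun _ : S => mean P f ^+ 2) by exact: bounded_meas_cst.
rewrite meanD//; last exact: bounded_measD.
by rewrite meanD// mean_cst meanZ// /Var; ring.
Qed.

Lemma Var_ge0 f : bounded_meas f -> 0 <= Var P f.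
Proof.
by move=> bf; rewrite -Var_center//; apply: Rintegral_ge0 => x _;
  exact: sqr_ge0.
Qed.

Lemma meanN f : bounded_meas f -> mean P (fun s => - f s) = - mean P f.
Proof.
move=> bf; have -> : (fun s => - f s) = fun s => -1 * f s.
  by apply/funext => s; rewrite mulN1r.
by rewrite meanZ// mulN1r.
Qed.

Lemma VarN f : bounded_meas f -> Var P (fun s => - f s) = Var P f.
Proof.
move=> bf; rewrite /Var meanN// sqrrN; congr (mean P _ - _).
by apply/funext => s; rewrite sqrrN.
Qed.

(** Chernoff's bound: the indicator of the event is at most the exponential of l (f - z). *)
Lemma markov_expR f (l z : R) : bounded_meas f -> 0 <= l ->
  (P [set x | (z <= f x)%R] <= (mean P (fun x =>
    expR (l * f x)) * expR (- (l * z)))%:E)%E.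
Proof.
move=> bf l0.
have be : bounded_meas (fun x => expR (l * f x)).
  exact/bounded_meas_expR/bounded_measZ.
have mA : measurable [set x | z <= f x].
  rewrite (_ : [set x | _] = f @^-1` `[z, +oo[); last first.
    by apply/seteqP; split => x /=; rewrite in_itv/= andbT.
  by rewrite -[X in measurable X]setTI; apply: bf.1 => //;
    exact: measurable_itv.
rewrite (_ : P _ = (mean P \1_[set x | z <= f x])%:E); last first.
  rewrite EFin_mean; last exact: bounded_meas_indic.
  by rewrite integral_indic// setIT.
rewrite lee_fin mulrC -meanZ//; apply: mean_le.
- exact: bounded_meas_indic.
- exact: bounded_measZ.
move=> x; rewrite indicE -expRD; case: (boolP (x \in _)) => /= [|_];
  last exact: expR_ge0.
rewrite inE/= => zf; rewrite -[leLHS]expR0 ler_expR addrC subr_ge0 ler_wpM2l//.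
Qed.

End bounded_meas.

(** * Resampling one coordinate *)

Definition upd {S : Type} {n : nat} (x : n.-tuple S) (i : 'I_n) (y : S) :
    n.-tuple S :=
  [tuple if j == i then y else tnth x j | j < n].

Definition rectangle {S : Type} {n : nat} (B : 'I_n -> set S) :
    set (n.-tuple S) :=
  [set x | forall i, B i (tnth x i)].

(** Not depending on coordinate [i] is stated as invariance under resampling it, which is the form
    needed to pull a factor out of a mean over that coordinate. *)
Definition indep_of {S A : Type} {n : nat} (i : 'I_n) (f : n.-tuple S -> A) :
    Prop :=
  forall x y, f (upd x i y) = f x.

Lemma tnth_upd (S : Type) n (x : n.-tuple S) i y j :
  tnth (upd x i y) j = if j == i then y else tnth x j.
Proof. by rewrite tnth_mktuple. Qed.

Lemma upd_upd (S : Type) n (x : n.-tuple S) i y z :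
  upd (upd x i y) i z = upd x i z.
Proof. by apply: eq_from_tnth => j; rewrite !tnth_upd; case: eqP. Qed.

Lemma updC (S : Type) n (x : n.-tuple S) i j y z : i != j ->
  upd (upd x i y) j z = upd (upd x j z) i y.
Proof.
move=> ij; apply: eq_from_tnth => k; rewrite !tnth_upd.
by have [->|//] := eqVneq k j; rewrite eq_sym (negbTE ij).
Qed.

Section resampling.
Context {d} {S : measurableType d} {R : realType} (P : probability S R).
Context {n : nat} (mu : probability (n.-tuple S) R).

Lemma measurable_upd_pair (i : 'I_n) :
  measurable_fun [set: (n.-tuple S * S)%type] (fun xy => upd xy.1 i xy.2).
Proof.
apply/measurable_fun_tnthP => j /=.
have [ji|ji] := eqVneq j i.
  apply: (eq_measurable_fun snd) => [xy _|]; last exact: measurable_snd.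
  by rewrite /= tnth_upd ji eqxx.
apply: (eq_measurable_fun ((@tnth n S ^~ j) \o fst)) => [xy _|].
  by rewrite /= tnth_upd (negbTE ji).
by apply: measurableT_comp; [exact: measurable_tnth|exact: measurable_fst].
Qed.

Lemma measurable_upd (x : n.-tuple S) i : measurable_fun [set: S] (upd x i).
Proof.
exact: measurableT_comp (measurable_upd_pair i) (measurable_pair1 x).
Qed.

Lemma measurable_rectangle (B : 'I_n -> set S) :
  (forall i, measurable (B i)) -> measurable (rectangle B).
Proof.
move=> mB; rewrite (_ : rectangle B = \bigcap_(i in [set: 'I_n]) (@tnth n S ^~
  i) @^-1` (B i)).
  apply: fin_bigcap_measurable => // i _; rewrite -[X in measurable X]setTI.
  exact: measurable_tnth.
by apply/seteqP; split => [x Bx i _|x Bx i]; exact: Bx.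
Qed.

(** Rectangles are stable under intersection, and they generate the sigma-algebra of tuples because
    the preimage of a set under one coordinate is a rectangle whose other sides are full. *)
Lemma rectangle_measure_unique (m1 m2 : {measure set (n.-tuple S) -> \bar R}) :
  (m1 [set: n.-tuple S] < +oo)%E ->
  (forall B, (forall i, measurable (B i)) ->
    m1 (rectangle B) = m2 (rectangle B)) ->
  forall A, measurable A -> m1 A = m2 A.
Proof.
move=> m1oo m12.
pose G : set (set (n.-tuple S)) :=
  [set rectangle B | B in [set B : 'I_n -> set S | forall i, measurable (B i)]].
have GT : G [set: n.-tuple S].
  exists (fun=> setT) => //=; by apply/seteqP; split => // x _ i.
apply: (measure_unique G (fun=> setT)) => //.
- rewrite eqEsubset; split; last first.
    apply: smallest_sub; first exact: sigma_algebra_measurable.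
    by move=> _ [B mB <-]; exact: measurable_rectangle.
  rewrite [X in X `<=` _]/measurable /=; apply: smallest_sub.
    exact: smallest_sigma_algebra.
  rewrite -bigcup_seq => A [i /= _ [B mB <-]].
  apply: sub_sigma_algebra; exists (fun j => if j == i then B else setT).
    by move=> j; case: ifP.
  apply/seteqP; split => x; rewrite /rectangle /=; first by move=> /(_ i);
    rewrite eqxx.
  by move=> [_ Bx] j; case: eqP => [->|].
- move=> _ _ [B mB <-] [C mC <-]; exists (fun i => B i `&` C i).
    by move=> i; exact: measurableI.
  apply/seteqP; split => x; rewrite /rectangle /=; last by move=> [? ?] i;
    split.
  by move=> BC; split => i; have [] := BC i.
- by apply/seteqP; split => // x _; exists 0%N.
- by move=> _ [B mB <-]; exact: m12.
Qed.

(** The operator E_i of the overview. Under a product law it is a version of the conditional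
    expectation given the other coordinates. *)
Definition cmean (i : 'I_n) (f : n.-tuple S -> R) (x : n.-tuple S) : R :=
  mean P (fun y => f (upd x i y)).

Lemma bounded_meas_upd (f : n.-tuple S -> R) x i : bounded_meas f ->
  bounded_meas (fun y => f (upd x i y)).
Proof.
move=> [mf [M fM]]; split; last by exists M.
by apply: measurableT_comp => //; exact: measurable_upd.
Qed.

Lemma cmean_indep i f : indep_of i (cmean i f).
Proof. by move=> x y; rewrite /cmean; under eq_fun do rewrite upd_upd. Qed.

Lemma indep_cmean i j f : indep_of j f -> indep_of j (cmean i f).
Proof.
move=> fj; have [->|ij] := eqVneq i j; first exact: cmean_indep.
move=> x y; rewrite /cmean; congr mean; apply/funext => z.
by rewrite updC 1?eq_sym// fj.
Qed.

Lemma cmean_mull i f g : bounded_meas f -> indep_of i g ->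
  cmean i (fun x => g x * f x) = (fun x => g x * cmean i f x).
Proof.
move=> bf gi; apply/funext => x; rewrite /cmean.
under eq_fun do rewrite gi.
by rewrite meanZ//; exact: bounded_meas_upd.
Qed.

Context (mu_rect : forall B : 'I_n -> set S, (forall i, measurable (B i)) ->
  mu (rectangle B) = (\prod_(i < n) P (B i))%E).

(** It suffices to compare on rectangles. There the preimage is a rectangle with full [i]-th side
    times [B i], and both sides equal the product of the [P (B j)]. *)
Lemma resample_measure i (A : set (n.-tuple S)) : measurable A ->
  pushforward (mu \x P)%E (fun xy : (n.-tuple S * S)%type =>
    upd xy.1 i xy.2) A = mu A.
Proof.
move: A.
pose upd' : {mfun (n.-tuple S * S)%type >-> n.-tuple S} :=
  mfun_Sub (mem_set (measurable_upd_pair i)).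
apply: (@rectangle_measure_unique (pushforward (mu \x P)%E upd')).
- apply: (@le_lt_trans _ _ 1%E); last exact: ltry.
  exact: (probability_le1 (mu \x P)%E measurableT).
move=> B mB.
transitivity ((mu \x P)%E
    (rectangle (fun j => if j == i then setT else B j) `*` B i)).
  congr (product_measure1 _ _ _).
  apply/seteqP; split => -[x y]; rewrite /rectangle/=.
    move=> Bxy; split; last by have := Bxy i; rewrite tnth_upd eqxx.
    by move=> j; have := Bxy j; rewrite tnth_upd; case: eqP.
  by move=> [Bx By] j; have := Bx j; rewrite tnth_upd; case: eqP => [->|].
have mB' j : measurable (if j == i then setT else B j) by case: ifP.
transitivity
  (mu (rectangle (fun j => if j == i then setT else B j)) * P (B i))%E.
  by apply: product_measure1E => //; exact: measurable_rectangle.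
rewrite mu_rect// (bigD1 i)//= eqxx [X in (X * _ * _)%E]probability_setT mul1e.
rewrite [RHS](mu_rect _ mB) [RHS](bigD1 i)//= muleC.
by congr (_ * _)%E; apply: eq_bigr => j /negbTE ->.
Qed.

Lemma bounded_meas_cmean i f : bounded_meas f -> bounded_meas (cmean i f).
Proof.
move=> bf; have [mf [M fM]] := bf; split; last first.
  by exists M => x; apply: mean_norm => //; exact: bounded_meas_upd.
(* Tonelli's theorem wants a nonnegative integrand, hence the shift by the bound [M], subtracted
   again below. *)
pose g (xy : n.-tuple S * S) := (f (upd xy.1 i xy.2) + M)%:E.
have mg : measurable_fun [set: (n.-tuple S * S)%type] g.
  apply/measurable_EFinP/measurable_funD; last exact: measurable_cst.
  by apply: measurableT_comp mf _; exact: measurable_upd_pair.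
have g0 xy : (0 <= g xy)%E.
  by rewrite lee_fin; have := fM (upd xy.1 i xy.2);
    rewrite ler_norml => /andP[]; lra.
have mG := measurable_fun_fubini_tonelli_F (m2 := P) g mg g0.
apply: (eq_measurable_fun (fun x => fine (fubini_F P g x) - M)).
  move=> x _; rewrite /fubini_F /g -EFin_mean.
    rewrite /= meanD ?mean_cst ?addrK//; first exact: bounded_meas_upd.
    exact: bounded_meas_cst.
  by apply: bounded_measD; [exact: bounded_meas_upd|exact: bounded_meas_cst].
apply: measurable_funB; last exact: measurable_cst.
by apply: measurableT_comp => //; exact: fine_measurable.
Qed.

(** Tower property: Tonelli turns the iterated mean into an integral over [mu \x P], and the image
    of that measure under resampling is [mu]. *)
Lemma mean_cmean i f : bounded_meas f -> mean mu (cmean i f) = mean mu f.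
Proof.
move=> bf; have [mf [M fM]] := bf.
pose h x := f x + M.
have h0 x : 0 <= h x.
  by have := fM x; rewrite /h ler_norml => /andP[]; lra.
have bh : bounded_meas h by apply: bounded_measD => //; exact: bounded_meas_cst.
suff : mean mu (cmean i h) = mean mu h.
  rewrite /h meanD ?mean_cst//; last exact: bounded_meas_cst.
  rewrite (_ : cmean i _ = (fun x => cmean i f x + M)).
    rewrite meanD ?mean_cst; first exact: addIr.
      exact: bounded_meas_cmean.
    exact: bounded_meas_cst.
  apply/funext => x; rewrite /cmean meanD ?mean_cst//.
    exact: bounded_meas_upd.
  exact: bounded_meas_cst.
apply: EFin_inj; rewrite !EFin_mean//; last exact: bounded_meas_cmean.
pose g (xy : n.-tuple S * S) := (h (upd xy.1 i xy.2))%:E.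
have mg : measurable_fun [set: (n.-tuple S * S)%type] g.
  apply/measurable_EFinP.
  by apply: measurableT_comp bh.1 _; exact: measurable_upd_pair.
transitivity (\int[mu]_x fubini_F P g x)%E.
  by apply: eq_integral => x _; rewrite /cmean EFin_mean//;
    exact: bounded_meas_upd.
rewrite -fubini_tonelli1//; last by move=> xy; rewrite lee_fin.
rewrite -[LHS](@ge0_integral_pushforward _ _ _ _ _ _ (measurable_upd_pair i)
  (mu \x P)%E setT (EFin \o h))//; last 2 first.
- by apply/measurable_EFinP; case: bh.
- by move=> x _; rewrite lee_fin.
apply: eq_measure_integral => [|mupd A mA _]; first exact: measurable_upd_pair.
exact: resample_measure.
Qed.

End resampling.

(** * Exponential inequalities *)

Lemma derive_ge0_ndecr (R : realType) (f f' : R -> R) (a b : R) : a <= b ->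
  (forall x : R, is_derive x 1 f (f' x)) -> (forall x, a <= x -> 0 <= f' x) ->
  f a <= f b.
Proof.
rewrite le_eqVlt => /predU1P[->//|ab] df f'0.
have cf : {within `[a, b], continuous f}.
  apply: continuous_subspaceT => x; apply: differentiable_continuous.
  exact/derivable1_diffP/ex_derive.
have [c /[!in_itv]/= /andP[ac _] fE] := MVT ab (fun x _ => df x) cf.
by rewrite -subr_ge0 fE mulr_ge0 ?f'0 ?ltW// subr_gt0.
Qed.

Section expR_bounds.
Context {R : realType}.
Implicit Types u : R.

(** The derivative of the difference is the difference for the Taylor polynomial of one degree less;
    the cubic bound repeats the argument. *)
Lemma expR_ge_quad u : 0 <= u -> 1 + u + u ^+ 2 / 2 <= expR u.
Proof.
move=> u0; pose f u : R := expR u - (1 + u + u ^+ 2 / 2).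
suff : f 0 <= f u by rewrite /f expR0; lra.
apply: (@derive_ge0_ndecr R f (fun u => expR u - (1 + u))) => //.
  by move=> x; rewrite /f; apply: is_derive_eq; rewrite /GRing.scale/=; field.
by move=> x _; rewrite subr_ge0 expR_ge1Dx.
Qed.

Lemma expR_ge_cubic u : 0 <= u ->
  1 + u + u ^+ 2 / 2 + u ^+ 3 / 6 <= expR u.
Proof.
move=> u0; pose f u : R := expR u - (1 + u + u ^+ 2 / 2 + u ^+ 3 / 6).
suff : f 0 <= f u by rewrite /f expR0; lra.
apply: (@derive_ge0_ndecr R f (fun u => expR u - (1 + u + u ^+ 2 / 2))) => //.
  by move=> x; rewrite /f; apply: is_derive_eq; rewrite /GRing.scale/=; field.
by move=> x x0; rewrite subr_ge0 expR_ge_quad.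
Qed.

(** For u < 2 this bounds the exponential by its Padé approximant (2 + u) / (2 - u). The derivative
    1 - (1 - u) exp(u) is nonnegative because 1 - u <= exp(-u). *)
Lemma expR_pade u : 0 <= u -> (2 - u) * expR u <= 2 + u.
Proof.
move=> u0; pose f u : R := 2 + u - (2 - u) * expR u.
suff : f 0 <= f u by rewrite /f expR0; lra.
apply: (@derive_ge0_ndecr R f (fun u => 1 - (1 - u) * expR u)) => //.
  by move=> x; rewrite /f; apply: is_derive_eq; rewrite /GRing.scale/=; field.
move=> x _; rewrite subr_ge0 -[leRHS]expR0 -(addNr x) expRD.
by rewrite ler_wpM2r ?expR_ge0// (le_trans _ (expR_ge1Dx _)).
Qed.

(** From the lower bound at -u, since (1 - u + u^2 / 2) (1 + u + u^2 / 2) = 1 + u^4 / 4 >= 1. *)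
Lemma expR_le_quad u : u <= 0 -> expR u <= 1 + u + u ^+ 2 / 2.
Proof.
move=> u0; have w0 : 0 <= - u by rewrite oppr_ge0.
have := expR_ge_quad _ w0; rewrite expRN => e1.
have e0 := expR_gt0 u.
have : 1 + - u + (- u) ^+ 2 / 2 > 0 by nra.
have : (1 + - u + (- u) ^+ 2 / 2) * expR u <= 1.
  by rewrite -ler_pdivlMr// mul1r.
nra.
Qed.

(** For u >= 0 the Padé bound is exactly 1 + u + u^2 / (2 - u); for u < 0 the quadratic bound is
    already stronger. *)
Lemma expR_bernstein (a u : R) : 0 <= a < 2 -> u <= a ->
  expR u <= 1 + u + u ^+ 2 / (2 - a).
Proof.
move=> /andP[a0 a2] ua; have a2' : 0 < 2 - a by lra.
have [u0|u0] := leP 0 u; last first.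
  apply: le_trans (expR_le_quad _ (ltW u0)) _; rewrite lerD2l.
  by rewrite ler_wpM2l ?sqr_ge0// lef_pV2 ?posrE//; lra.
have u2 : 0 < 2 - u by lra.
have : expR u <= 1 + u + u ^+ 2 / (2 - u).
  rewrite (_ : _ + _ = (2 + u) / (2 - u)); first by rewrite ler_pdivlMr// mulrC
    expR_pade.
  by field; rewrite lt0r_neq0.
move=> /le_trans; apply; rewrite lerD2l ler_wpM2l ?sqr_ge0//.
by rewrite lef_pV2 ?posrE//; lra.
Qed.

(** The left side is 1 - (1 - u) exp(u). For u >= 0 the cubic bound leaves u^2 (1/2 + u/3 + u^2/6),
    whose factor is 17/24 at u = 1/2; for u < 0 the Padé bound at -u leaves u^2 / (2 - u). *)
Lemma expR_entropy_bound u : `|u| <= 1 / 2 ->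
  u * expR u - expR u + 1 <= 3 / 4 * u ^+ 2.
Proof.
rewrite ler_norml => /andP[u1 u2]; have [u0|u0] := leP 0 u.
  have /(ler_wpM2l (_ : 0 <= 1 - u)) := expR_ge_cubic _ u0.
  have -> : 0 <= 1 - u by lra.
  move=> /(_ isT).
  have : 0 <= u * u by rewrite mulr_ge0.
  have : 0 <= u * u * (1/2 - u) by rewrite !mulr_ge0//; lra.
  have : 0 <= u * u * (1/2 - u) * u by rewrite !mulr_ge0//; lra.
  rewrite !exprS expr0; nra.
have w0 : 0 <= - u by lra.
have := expR_pade _ w0; rewrite expRN.
have e0 := expR_gt0 u.
rewrite ler_pdivrMr// => h.
have : 2 + u <= (2 - u) * expR u by lra.
have := expR_ge0 u.
set e := expR u in e0 h *; clearbody e => _ k.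
rewrite -subr_ge0 -(pmulr_rge0 _ (_ : 0 < 2 - u)); last by lra.
have : (1 - u) * (2 + u) <= (1 - u) * ((2 - u) * e) by rewrite ler_wpM2l//; lra.
have : 0 <= (- u) * u ^+ 2 by rewrite mulr_ge0// sqr_ge0.
have : 0 <= u ^+ 2 by rewrite sqr_ge0.
rewrite !exprS expr0; nra.
Qed.

End expR_bounds.

(** * Concentration of suprema *)

Section tensorization.
Context {d} {S : measurableType d} {R : realType} (P : probability S R).
Context {n : nat} (mu : probability (n.-tuple S) R).
Context (mu_rect : forall B : 'I_n -> set S, (forall i, measurable (B i)) ->
  mu (rectangle B) = (\prod_(i < n) P (B i))%E).

(** The coordinates of [x] are replaced by those of [y] one at a time. *)
Lemma indep_all_cst (f : n.-tuple S -> R) :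
  (forall i, indep_of i f) -> forall x y, f x = f y.
Proof.
move=> fi x y.
suff H (r : seq 'I_n) x' : (forall i, i \notin r -> tnth x' i = tnth y i) ->
    f x' = f y.
  by apply: (H (enum 'I_n)) => i; rewrite mem_enum.
elim: r x' => [|i r IH] x' xy.
  by congr f; apply: eq_from_tnth => i; exact: xy.
rewrite -(fi i x' (tnth y i)); apply: IH => j jr; rewrite tnth_upd.
by case: eqP => [->//|/eqP ji]; apply: xy; rewrite inE negb_or ji.
Qed.

Definition cmeans (r : seq 'I_n) (f : n.-tuple S -> R) : n.-tuple S -> R :=
  foldl (fun g i => cmean P i g) f r.

Lemma mean_cmeans r f : bounded_meas f -> mean mu (cmeans r f) = mean mu f.
Proof.
elim: r f => //= i r IH f bf; rewrite IH ?(mean_cmean P mu mu_rect)//.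
exact: (bounded_meas_cmean P).
Qed.

Lemma indep_cmeans r f i : i \in r \/ indep_of i f -> indep_of i (cmeans r f).
Proof.
elim: r f => [|j r IH] f /=; first by case.
move=> [|fi]; last by apply: IH; right; exact: indep_cmean.
rewrite inE => /predU1P[ij|ir]; last by apply: IH; left.
by apply: IH; right; rewrite ij; exact: cmean_indep.
Qed.

(** Once every coordinate is integrated out the function is constant, and each step has preserved
    the mean. *)
Lemma cmeans_enum f x : bounded_meas f -> cmeans (enum 'I_n) f x = mean mu f.
Proof.
move=> bf; rewrite -(mean_cmeans (enum 'I_n))//.
rewrite (_ : cmeans _ f = fun=> cmeans (enum 'I_n) f x) ?mean_cst//.
apply/funext => y; apply: indep_all_cst => i; apply: indep_cmeans.
by left; rewrite mem_enum.
Qed.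

Lemma le_cmean m (f : n.-tuple S -> R) i x : bounded_meas f ->
  (forall x, m <= f x) -> m <= cmean P i f x.
Proof.
move=> bf mf; rewrite -(mean_cst P m); apply: mean_le => //.
  exact: bounded_meas_cst.
exact: bounded_meas_upd.
Qed.

(* Young's inequality [f ln a <= f ln (f / c) - f + c a] with [a = g / E_i g],
   whose conditional mean is [1]. *)
Lemma entropy_step (m : R) (f g c : n.-tuple S -> R) (i : 'I_n) :
  0 < m -> bounded_meas f -> bounded_meas g -> bounded_meas c ->
  (forall x, m <= f x) -> (forall x, m <= g x) -> (forall x, m <= c x) ->
  indep_of i c ->
  mean mu (fun x => f x * ln (g x)) - mean mu (fun x =>
    f x * ln (cmean P i g x))
  <= mean mu (fun x => f x * (ln (f x) - ln (c x)) - f x + c x).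
Proof.
move=> m0 bf bg bc mf mg mc ci.
have bg' := bounded_meas_cmean P i g bg.
have mg' x : m <= cmean P i g x by exact: le_cmean.
have blf := bounded_meas_ln f m m0 mf bf.
have blg := bounded_meas_ln g m m0 mg bg.
have blc := bounded_meas_ln c m m0 mc bc.
have blg' := bounded_meas_ln _ m m0 mg' bg'.
have bV : bounded_meas (fun x => c x * (cmean P i g x)^-1).
  rewrite (_ : (fun x => _) = fun x => c x * expR (- ln (cmean P i g x))).
    exact/bounded_measM/bounded_meas_expR/bounded_measN.
  apply/funext => x; rewrite expRN lnK// posrE; exact: lt_le_trans (mg' x).
have bG : bounded_meas (fun x => f x * (ln (f x) - ln (c x)) - f x).
  by apply: bounded_measB => //; apply: bounded_measM => //;
    exact: bounded_measB.
have bH : bounded_meas (fun x => c x * (cmean P i g x)^-1 * g x).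
  exact: bounded_measM.
rewrite -meanB//; [|exact: bounded_measM|exact: bounded_measM].
rewrite [leRHS]meanD//.
have -> : mean mu (fun x => c x) = mean mu (fun x =>
  c x * (cmean P i g x)^-1 * g x).
  rewrite -[RHS](mean_cmean P mu mu_rect i)//.
  rewrite cmean_mull//; last first.
    by move=> x y; rewrite ci cmean_indep.
  congr mean; apply/funext => x; rewrite divfK//.
  by rewrite gt_eqF// (lt_le_trans m0).
rewrite -[leRHS]meanD//; apply: mean_le.
- by apply: bounded_measB => //; exact: bounded_measM.
- exact: bounded_measD.
move=> x; have f0 := lt_le_trans m0 (mf x); have g0 := lt_le_trans m0 (mg x).
have g'0 := lt_le_trans m0 (mg' x); have c0 := lt_le_trans m0 (mc x).
set g' := cmean P i g x in g'0 *.
pose a := c x / g' * g x / f x.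
have a0 : 0 < a by rewrite /a !(mulr_gt0, invr_gt0, divr_gt0).
have lna : ln a = ln (c x) - ln g' + ln (g x) - ln (f x).
  by rewrite /a ln_div ?posrE ?mulr_gt0 ?invr_gt0// lnM ?posrE ?divr_gt0//
    ln_div ?posrE.
have := expR_ge1Dx (ln a); rewrite lnK ?posrE// lna => h.
have -> : c x * g'^-1 * g x = f x * a by rewrite /a; field; rewrite !gt_eqF.
have := ler_wpM2l (ltW f0) h; nra.
Qed.

(** The weight [f] stays fixed while the argument of the logarithm passes from [f] to its mean, one
    coordinate being integrated out at a time. The logarithms telescope and [entropy_step] bounds
    each increment. The [c i] are free comparison functions; the supremum without the [i]-th point
    will be used for them. *)
Lemma entropy_tensorization (m : R) (f : n.-tuple S -> R)
    (c : 'I_n -> n.-tuple S -> R) :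
  0 < m -> bounded_meas f -> (forall i, bounded_meas (c i)) ->
  (forall x, m <= f x) -> (forall i x, m <= c i x) ->
  (forall i, indep_of i (c i)) ->
  mean mu (fun x => f x * ln (f x)) - mean mu f * ln (mean mu f) <=
  \sum_(i < n) mean mu (fun x => f x * (ln (f x) - ln (c i x)) - f x + c i x).
Proof.
move=> m0 bf bc mf mc ci.
have H (r : seq 'I_n) g : bounded_meas g -> (forall x, m <= g x) ->
    mean mu (fun x => f x * ln (g x)) - mean mu (fun x =>
      f x * ln (cmeans r g x))
    <= \sum_(i <- r) mean mu (fun x => f x * (ln (f x) - ln (c i x)) - f x + c
      i x).
  elim: r g => [|i r IH] g bg mg; first by rewrite big_nil subrr.
  rewrite big_cons /=.
  have h1 := entropy_step m f g (c i) i m0 bf bg (bc i) mf mg (mc i) (ci i).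
  have h2 := IH _ (bounded_meas_cmean P i g bg) (fun x =>
    le_cmean m g i x bg mg).
  lra.
have := H (enum 'I_n) f bf mf; rewrite big_enum/=.
rewrite (_ : (fun x => f x * ln (cmeans _ _ x)) =
  (fun x => ln (mean mu f) * f x)) ?meanZ//; last first.
  by apply/funext => x; rewrite cmeans_enum// mulrC.
by rewrite [_ * mean mu f]mulrC.
Qed.

End tensorization.

(** The predicate covers both suprema of the overview: Z is the case [predT] and Z_i the case
    [predC1 i]. *)
Definition supsum {S : Type} {R : realType} {n : nat} (T : set (S -> R))
    (a : pred 'I_n) (x : n.-tuple S) : R :=
  sup [set \sum_(j | a j) xi (tnth x j) | xi in T].

Section supsum.
Context {S : Type} {R : realType} {n : nat} (T : set (S -> R)).
Context (T_neq0 : T !=set0) (T_le1 : forall xi, T xi -> forall s, `|xi s| <= 1).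
Implicit Types (a : pred 'I_n) (x : n.-tuple S) (i : 'I_n).

Lemma norm_sum_le a x xi : T xi -> `|\sum_(j | a j) xi (tnth x j)| <= n%:R.
Proof.
move=> Txi; rewrite (le_trans (ler_norm_sum _ _ _))//.
apply: (@le_trans _ _ (\sum_(j < n) 1)); last first.
  by rewrite sumr_const card_ord.
rewrite [leRHS](bigID a)/= -[leLHS]addr0 lerD// ?sumr_ge0//.
by apply: ler_sum => j _; exact: T_le1.
Qed.

Lemma has_sup_supsum a x :
  has_sup [set \sum_(j | a j) xi (tnth x j) | xi in T].
Proof.
split; first by have [xi Txi] := T_neq0; exists (\sum_(j | a j) xi (tnth x j)),
  xi.
exists n%:R => _ [xi Txi <-]; exact: le_trans (ler_norm _) (norm_sum_le a x xi
  Txi).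
Qed.

Lemma supsum_ge a x xi : T xi -> \sum_(j | a j) xi (tnth x j) <= supsum T a x.
Proof.
by move=> Txi; apply: ub_le_sup; [case: (has_sup_supsum a x)|exists xi].
Qed.

Lemma supsum_le a x M :
  (forall xi, T xi -> \sum_(j | a j) xi (tnth x j) <= M) -> supsum T a x <= M.
Proof.
move=> TM; apply: ge_sup; first by case: (has_sup_supsum a x).
by move=> _ [xi Txi <-]; exact: TM.
Qed.

Lemma supsum_adherent a x eta : 0 < eta ->
  exists2 xi, T xi & supsum T a x - eta < \sum_(j | a j) xi (tnth x j).
Proof.
move=> eta0; have [_ [xi Txi <-] h] := sup_adherent eta0 (has_sup_supsum a x).
by exists xi.
Qed.

Lemma norm_supsum_le a x : `|supsum T a x| <= n%:R.
Proof.
rewrite ler_norml; apply/andP; split; last first.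
  by apply: supsum_le => xi Txi; exact: le_trans (ler_norm _) (norm_sum_le a x
    xi Txi).
have [xi Txi] := T_neq0; apply: le_trans (supsum_ge a x xi Txi).
by have := norm_sum_le a x xi Txi; rewrite ler_norml => /andP[].
Qed.

Lemma sum_upd i x y (xi : S -> R) :
  \sum_(j | predC1 i j) xi (tnth (upd x i y) j) =
  \sum_(j | predC1 i j) xi (tnth x j).
Proof. by apply: eq_bigr => j /negbTE ji; rewrite tnth_upd ji. Qed.

Lemma supsum_indep i : indep_of i (supsum T (predC1 i)).
Proof.
move=> x y; rewrite /supsum; congr sup; apply/seteqP; split => _ [xi Txi <-];
  by exists xi => //; rewrite sum_upd.
Qed.

Lemma sum_split i x (xi : S -> R) :
  \sum_(j < n) xi (tnth x j) =
  xi (tnth x i) + \sum_(j | predC1 i j) xi (tnth x j).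
Proof. by rewrite (bigD1 i). Qed.

Lemma supsum_diff_le i x : supsum T predT x - supsum T (predC1 i) x <= 1.
Proof.
rewrite lerBlDr; apply: supsum_le => xi Txi.
rewrite (sum_split i) lerD ?(supsum_ge _ _ xi)//.
exact: le_trans (ler_norm _) (T_le1 _ Txi _).
Qed.

(** The near-maximizer [xi] is chosen for the sum without the [i]-th point, hence before [y]. This
    uniformity in [y] is what allows the bound to be integrated over [y]. *)
Lemma supsum_diff_ge i x eta : 0 < eta ->
  exists2 xi, T xi & forall y,
    xi y - eta <= supsum T predT (upd x i y) - supsum T (predC1 i) x.
Proof.
move=> eta0; have [xi Txi h] := supsum_adherent (predC1 i) x eta eta0.
exists xi => // y; have := supsum_ge predT (upd x i y) xi Txi.
rewrite (sum_split i) sum_upd tnth_upd eqxx; lra.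
Qed.

Lemma sum_supsum_diff x :
  \sum_(i < n) (supsum T predT x - supsum T (predC1 i) x) <= supsum T predT x.
Proof.
apply/ler_addgt0Pr => e e0.
(* The error is incurred [n] times; [n.+1] keeps the quotient meaningful for [n = 0]. *)
pose eta := e / n.+1%:R.
have eta0 : 0 < eta by rewrite divr_gt0.
have [xi Txi h] := supsum_adherent predT x eta eta0.
apply: (@le_trans _ _ (\sum_(i < n) (xi (tnth x i) + eta))).
  apply: ler_sum => i _; have := supsum_ge (predC1 i) x xi Txi.
  move: h; rewrite (sum_split i); lra.
rewrite big_split/= sumr_const card_ord lerD ?(supsum_ge _ _ xi)//.
rewrite /eta -[leLHS]mulr_natr -mulrA ger_pMr// mulrC ler_pdivrMr// mul1r.
by rewrite ler_nat.
Qed.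

End supsum.

(** * Moments of the increments and the differential inequality for the exponential moment *)

Section concentration.
Context {d} {S : measurableType d} {R : realType} (P : probability S R).
Context {n : nat} (mu : probability (n.-tuple S) R).
Context (mu_rect : forall B : 'I_n -> set S, (forall i, measurable (B i)) ->
  mu (rectangle B) = (\prod_(i < n) P (B i))%E).
Context (T : set (S -> R)) (v : R).
Context (T_neq0 : T !=set0) (T_le1 : forall xi, T xi -> forall s, `|xi s| <= 1).
Context (T_meas : forall xi, T xi -> measurable_fun [set: S] xi).
Context (T_mean : forall xi, T xi -> mean P xi = 0).
Context (T_var : forall xi, T xi -> mean P (fun s => xi s ^+ 2) <= v).
Context (supsum_meas : forall a : pred 'I_n, measurable_fun [set: n.-tuple S]
  (supsum T a)).

Local Notation Z := (@supsum S R n T predT).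
Local Notation Zi i := (@supsum S R n T (predC1 i)).

Lemma bounded_meas_supsum (a : pred 'I_n) : bounded_meas (supsum T a).
Proof. by split => //; exists n%:R => x; exact: norm_supsum_le. Qed.

Lemma bounded_meas_T xi : T xi -> bounded_meas xi.
Proof. by move=> Txi; split; [exact: T_meas|exists 1 => s; exact: T_le1]. Qed.

(** The increment is a function of the resampled point alone, so that its conditional moments are
    means over [P]. *)
Let Y (i : 'I_n) (x : n.-tuple S) (y : S) : R := Z (upd x i y) - Zi i x.

Lemma bounded_meas_Y i x : bounded_meas (Y i x).
Proof.
apply: bounded_measB; last exact: bounded_meas_cst.
exact/bounded_meas_upd/bounded_meas_supsum.
Qed.

Lemma Y_le1 i x y : Y i x y <= 1.
Proof.
rewrite /Y -(supsum_indep T i x y); exact: supsum_diff_le.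
Qed.

Lemma Y_geN1 i x y : -1 <= Y i x y.
Proof.
apply/ler_addgt0Pr => e e0.
have [xi Txi h] := supsum_diff_ge T T_neq0 T_le1 i x e e0.
have := h y; have := T_le1 xi Txi y; rewrite ler_norml /Y => /andP[]; lra.
Qed.

Lemma var_ge0 : 0 <= v.
Proof.
have [xi Txi] := T_neq0; apply: le_trans (T_var xi Txi).
by apply: Rintegral_ge0 => x _; exact: sqr_ge0.
Qed.

Lemma mean_Y_ge0 i x : 0 <= mean P (Y i x).
Proof.
apply/ler_addgt0Pr => e e0.
have [xi Txi h] := supsum_diff_ge T T_neq0 T_le1 i x e e0.
have bxi := bounded_meas_T xi Txi.
have : mean P (fun y => xi y - e) <= mean P (Y i x).
  apply: mean_le => //; last exact: bounded_meas_Y.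
  by apply: bounded_measB => //; exact: bounded_meas_cst.
rewrite meanB//; last exact: bounded_meas_cst.
by rewrite T_mean// mean_cst sub0r -subr_ge0 opprK addrC.
Qed.

(** The map a -> a^2 - 2 a decreases on a <= 1, and xi - eta <= Y <= 1; hence Y^2 - 2 Y <= (xi -
    eta)^2 - 2 (xi - eta). Since [xi] is centered, the right side has mean at most v + 2 eta +
    eta^2. *)
Lemma mean_Y2_le i x : mean P (fun y => Y i x y ^+ 2) <= v + 2 * mean P (Y i x).
Proof.
apply/ler_addgt0Pr => e e0.
pose eta := Num.min 1 (e / 3).
have eta0 : 0 < eta by rewrite lt_min ltr01 divr_gt0.
have [eta1 etae] : eta <= 1 /\ eta <= e / 3 by rewrite !ge_min !lexx orbT.
have [xi Txi h] := supsum_diff_ge T T_neq0 T_le1 i x eta eta0.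
have bxi := bounded_meas_T xi Txi.
have bY := bounded_meas_Y i x.
have bce := bounded_meas_cst eta : bounded_meas (fun _ : S => eta).
have bc2 := bounded_meas_cst (2 * eta + eta ^+ 2) : bounded_meas (fun _ : S =>
  2 * eta + eta ^+ 2).
have b1 : bounded_meas (fun y => xi y ^+ 2) by exact: bounded_measX.
have b2 : bounded_meas (fun y => (- 2 * eta - 2) * xi y) by exact:
  bounded_measZ.
have b3 : bounded_meas (fun y => 2 * Y i x y) by exact: bounded_measZ.
have b12 := bounded_measD _ _ b1 b2; have b123 := bounded_measD _ _ b12 b3.
apply: (@le_trans _ _ (mean P (fun y => xi y ^+ 2 + (- 2 * eta - 2) * xi y + 2
  * Y i x y + (2 * eta + eta ^+ 2)))).
  apply: mean_le.
  - exact: bounded_measX.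
  - exact: bounded_measD.
  move=> y; have := h y; rewrite -/(Y i x y) => h1.
  have := Y_le1 i x y; have := T_le1 xi Txi y;
    rewrite ler_norml => /andP[h2 h3] h4.
  have : 0 <= (Y i x y - (xi y - eta)) * (2 - Y i x y - (xi y - eta)).
    by apply: mulr_ge0; lra.
  nra.
rewrite meanD// meanD// meanD// mean_cst.
rewrite !meanZ// (T_mean xi Txi) mulr0 addr0.
have := T_var xi Txi.
have : eta ^+ 2 <= eta by rewrite expr2 ler_piMl// ltW.
lra.
Qed.

(** After the [i]-th point is integrated out, exp(l Z_i) factors out of both sides, and what remains
    is [expR_entropy_bound] at u = l Y, where |u| <= 1/2. *)
Lemma entropy_term_le i (l : R) : 0 <= l <= 1 / 2 ->
  mean mu (fun x => expR (l * Z x) * (ln (expR (l * Z x)) - ln (expR (l * Zi i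
    x)))
    - expR (l * Z x) + expR (l * Zi i x))
  <= 3 / 4 * l ^+ 2 * (v * mean mu (fun x => expR (l * Z x))
       + 2 * mean mu (fun x => (Z x - Zi i x) * expR (l * Z x))).
Proof.
move=> /andP[l0 l1].
have bZ := bounded_meas_supsum predT; have bZi :=
  bounded_meas_supsum (predC1 i).
have bE : bounded_meas (fun x => expR (l * Z x)).
  exact/bounded_meas_expR/bounded_measZ.
have bEi : bounded_meas (fun x => expR (l * Zi i x)).
  exact/bounded_meas_expR/bounded_measZ.
have bD : bounded_meas (fun x => Z x - Zi i x) by exact: bounded_measB.
have bDE : bounded_meas (fun x => (Z x - Zi i x) * expR (l * Z x)) by exact:
  bounded_measM.
rewrite -(meanZ mu v)// -(meanZ mu 2)// -meanD; [|exact: bounded_measZ..].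
rewrite -meanZ; last by apply: bounded_measD; exact: bounded_measZ.
set F := (X in mean mu X <= _); set G := (X in _ <= mean mu X).
have FE : F = fun x => expR (l * Z x) * (l * Z x - l * Zi i x) - expR (l * Z x)
  + expR (l * Zi i x).
  by apply/funext => x; rewrite /F !expRK.
have bF : bounded_meas F.
  rewrite FE; apply: bounded_measD => //; apply: bounded_measB => //.
  by apply: bounded_measM => //; apply: bounded_measB; exact: bounded_measZ.
have bG : bounded_meas G.
  by apply/bounded_measZ/bounded_measD; exact: bounded_measZ.
rewrite -(mean_cmean P mu mu_rect i F)// -(mean_cmean P mu mu_rect i G)//.
apply: mean_le; [exact: bounded_meas_cmean..|move=> x].
have bY := bounded_meas_Y i x.
set z := Zi i x.
have Zupd y : Z (upd x i y) = Y i x y + z by rewrite /Y subrK.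
have bYE : bounded_meas (fun y => expR (l * Y i x y)) by
  exact/bounded_meas_expR/bounded_measZ.
have bYYE : bounded_meas (fun y => Y i x y * expR (l * Y i x y)) by exact:
  bounded_measM.
have -> : cmean P i F x = expR (l * z) * mean P (fun y =>
    (l * Y i x y) * expR (l * Y i x y) - expR (l * Y i x y) + 1).
  rewrite -meanZ; last first.
    apply: bounded_measD; last exact: bounded_meas_cst.
    by apply: bounded_measB => //; apply: bounded_measM => //;
      exact: bounded_measZ.
  rewrite /cmean; congr mean; apply/funext => y.
  rewrite FE (supsum_indep T i x y) -/z Zupd [l * (_ + _)]mulrDr expRD; ring.
have -> : cmean P i G x = expR (l * z) * (3 / 4 * l ^+ 2 * (v * mean P (fun y
  => expR (l * Y i x y))
    + 2 * mean P (fun y => Y i x y * expR (l * Y i x y)))).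
  rewrite -(meanZ P v)// -(meanZ P 2)// -meanD; [|exact: bounded_measZ..].
  have bS : bounded_meas (fun y => v * expR (l * Y i x y) + 2 * (Y i x y * expR
    (l * Y i x y))).
    by apply: bounded_measD; exact: bounded_measZ.
  rewrite -(meanZ P (3 / 4 * l ^+ 2))// -meanZ; last exact: bounded_measZ.
  rewrite /cmean; congr mean; apply/funext => y.
  rewrite /G (supsum_indep T i x y) -/z Zupd [l * (_ + _)]mulrDr expRD; ring.
rewrite ler_wpM2l ?expR_ge0//.
apply: (@le_trans _ _ (3 / 4 * l ^+ 2 * mean P (fun y => Y i x y ^+ 2))).
  rewrite -meanZ; last exact: bounded_measX.
  apply: mean_le; last first.
  - move=> y; rewrite -[leRHS]mulrA -exprMn; apply: expR_entropy_bound.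
    have := Y_le1 i x y; have := Y_geN1 i x y => h1 h2.
    by rewrite normrM (ger0_norm l0) (le_trans (ler_piMr l0 _)) ?ler_norml ?h1.
  - exact/bounded_measZ/bounded_measX.
  - apply: bounded_measD; last exact: bounded_meas_cst.
    by apply: bounded_measB => //; apply: bounded_measM => //;
      exact: bounded_measZ.
apply: ler_wpM2l; first by rewrite mulr_ge0// sqr_ge0.
(* The exponential weights are put back: 1 <= E exp(l Y) because E Y >= 0, and Y <= Y exp(l Y)
   pointwise for either sign of Y. *)
apply: le_trans (mean_Y2_le i x) _; apply: lerD.
  rewrite -[leLHS]mulr1 ler_wpM2l ?var_ge0//.
  have : mean P (fun y => 1 + l * Y i x y) <= mean P (fun y =>
    expR (l * Y i x y)).
    apply: mean_le => //; last by move=> y; exact: expR_ge1Dx.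
    by apply: bounded_measD; [exact: bounded_meas_cst|exact: bounded_measZ].
  rewrite meanD ?mean_cst ?meanZ//; [|exact: bounded_meas_cst|exact:
    bounded_measZ].
  by apply: le_trans; rewrite lerDl mulr_ge0 ?mean_Y_ge0.
rewrite ler_wpM2l//; apply: mean_le => // y.
have [Y0|Y0] := leP 0 (Y i x y).
  by rewrite ler_peMr// -expR0 ler_expR mulr_ge0.
by rewrite ler_niMr ?(ltW Y0)// -expR0 ler_expR mulr_ge0_le0// ltW.
Qed.

Lemma entropy_supsum_le (l : R) : 0 <= l <= 1 / 2 ->
  mean mu (fun x => l * Z x * expR (l * Z x))
    - mean mu (fun x => expR (l * Z x)) * ln (mean mu (fun x => expR (l * Z x)))
  <= 3 / 4 * l ^+ 2 * (n%:R * v * mean mu (fun x => expR (l * Z x))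
       + 2 * mean mu (fun x => Z x * expR (l * Z x))).
Proof.
move=> l01; have /andP[l0 l1] := l01.
have bZ := bounded_meas_supsum predT.
have bE (a : pred 'I_n) : bounded_meas (fun x : n.-tuple S =>
  expR (l * supsum T a x)).
  by apply/bounded_meas_expR/bounded_measZ; exact: bounded_meas_supsum.
(* Tensorization takes logarithms, so it asks for a common positive lower bound. *)
have lb (a : pred 'I_n) x : expR (- (l * n%:R)) <= expR (l * supsum T a x).
  rewrite ler_expR -mulrN ler_wpM2l//.
  by have := norm_supsum_le T T_neq0 T_le1 a x; rewrite ler_norml => /andP[].
have := entropy_tensorization P mu mu_rect (expR (- (l * n%:R)))
  (fun x => expR (l * Z x)) (fun i x => expR (l * Zi i x)) (expR_gt0 _)
  (bE predT) (fun i => bE (predC1 i)) (lb predT) (fun i x => lb (predC1 i) x).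
have ind i : indep_of i (fun x => expR (l * Zi i x)).
  by move=> x y; rewrite (supsum_indep T i x y).
move=> /(_ ind).
have -> : (fun x => expR (l * Z x) * ln (expR (l * Z x))) = (fun x =>
  l * Z x * expR (l * Z x)).
  by apply/funext => x; rewrite expRK mulrC.
move=> /le_trans; apply.
apply: le_trans (ler_sum _ (fun i _ => entropy_term_le i l l01)) _.
rewrite -mulr_sumr ler_wpM2l ?mulr_ge0 ?sqr_ge0//.
rewrite big_split/= sumr_const card_ord -[_ *+ n]mulr_natl mulrA lerD2l
  -mulr_sumr ler_wpM2l//.
rewrite -(mean_sum mu _ (index_enum 'I_n) (fun i x =>
  (Z x - Zi i x) * expR (l * Z x))).
  apply: mean_le.
  - apply: bounded_meas_sum => i _; apply: bounded_measM; last exact: bE.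
    by apply: bounded_measB => //; exact: bounded_meas_supsum.
  - by apply: bounded_measM => //; exact: bE.
  move=> x; rewrite -mulr_suml ler_wpM2r ?expR_ge0//; exact: sum_supsum_diff.
move=> i _; apply: bounded_measM; last exact: bE.
by apply: bounded_measB => //; exact: bounded_meas_supsum.
Qed.

Lemma mean_supsum_ge0 : 0 <= mean mu Z.
Proof.
have [xi Txi] := T_neq0; have bxi := bounded_meas_T xi Txi.
have bj (j : 'I_n) : bounded_meas (fun x : n.-tuple S => xi (tnth x j)).
  have [mxi [M xiM]] := bxi; split; last by exists M.
  by apply: measurableT_comp mxi _; exact: measurable_tnth.
apply: (@le_trans _ _ (mean mu (fun x => \sum_(j < n) xi (tnth x j)))).
  rewrite mean_sum// big1// => j _.
  rewrite -(mean_cmean P mu mu_rect j)//.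
  rewrite (_ : cmean _ _ _ = fun=> 0) ?mean_cst//.
  apply/funext => x; rewrite /cmean -[RHS](T_mean xi Txi).
  by congr mean; apply/funext => y; rewrite tnth_upd eqxx.
apply: mean_le; [exact: bounded_meas_sum|exact: bounded_meas_supsum|].
by move=> x; exact: (supsum_ge T T_neq0 T_le1 predT x xi).
Qed.

End concentration.

(** * Herbst's argument: from the differential inequality to a tail bound *)

Section herbst.
Context {d} {S : measurableType d} {R : realType} (mu : probability S R).
Context (Z : S -> R) (s M : R).
Context (mZ : measurable_fun [set: S] Z) (M0 : 0 < M) (ZM : forall x, `|Z x|
  <= M).
Context (s0 : 0 <= s) (EZ0 : 0 <= mean mu Z).

Let H (l : R) := mean mu (fun x => expR (l * Z x)).
Let H1 (l : R) := mean mu (fun x => Z x * expR (l * Z x)).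

Context (HH1 : forall l, 0 <= l <= 1 / 2 ->
  l * H1 l - H l * ln (H l) <= 3 / 4 * l ^+ 2 * (s * H l + 2 * H1 l)).

Let bZ : bounded_meas Z. Proof. by split => //; exists M. Qed.

Let bE l : bounded_meas (fun x => expR (l * Z x)).
Proof. exact/bounded_meas_expR/bounded_measZ. Qed.

Lemma mgf_gt0 l : 0 < H l.
Proof.
apply: lt_le_trans (expR_gt0 (- `|l| * M)) _.
rewrite -(mean_cst mu (expR _)); apply: mean_le => //;
  first exact: bounded_meas_cst.
move=> x; rewrite ler_expR mulNr lerNl.
rewrite (le_trans (ler_norm _))// normrN normrM ler_wpM2l//.
Qed.

(** Differentiation under the integral sign on a unit neighbourhood of [l], where the derivative is
    dominated by a constant. *)
Lemma is_derive_mgf (l : R) : is_derive l 1 H (H1 l).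
Proof.
have df (x : R) y : is_derive x 1 (fun l => expR (l * Z y)) (Z y * expR (x * Z
  y)).
  by apply: is_derive_eq; rewrite /GRing.scale/= mulr0 add0r mulr1 mulrC.
have d1E x y : partial1of2 (fun (l : R) (y : S) =>
  expR (l * Z y)) x y = Z y * expR (x * Z y).
  by rewrite partial1of2E; exact: derive_val.
pose G (y : S) : R := M * expR ((`|l| + 1) * M).
have lI : `]l - 1, l + 1[%classic l by rewrite /= in_itv/=; apply/andP; split;
  lra.
have intf (x : R) : `]l - 1, l + 1[%classic x ->
  mu.-integrable setT (EFin \o (fun y => expR (x * Z y))).
  by move=> _; exact: bounded_meas_integrable.
have derf (x : R) (y : S) : `]l - 1, l + 1[%classic x -> setT y ->
    derivable (fun l : R => expR (l * Z y)) x 1.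
  by move=> _ _; exact: ex_derive.
have G0 y : 0 <= G y by rewrite mulr_ge0 ?expR_ge0// ltW.
have intG : mu.-integrable setT (EFin \o G).
  exact/bounded_meas_integrable/bounded_meas_cst.
have Gub (x : R) (y : S) : `]l - 1, l + 1[%classic x -> setT y ->
    `|partial1of2 (fun (l : R) (y : S) => expR (l * Z y)) x y| <= G y.
  rewrite /= in_itv/= => /andP[x1 x2] _; rewrite d1E normrM.
  rewrite ler_pM// ger0_norm ?expR_ge0// ler_expR.
  rewrite (le_trans (ler_norm _))// normrM ler_pM//.
  by rewrite ler_norml; have := ler_norm l; have := ler_norm (- l);
    rewrite normrN => *; apply/andP; split; lra.
apply: DeriveDef.
  exact: (derivable_under_integral measurableT lI intf derf G0 intG Gub).
rewrite -derive1E.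
rewrite [LHS](differentiation_under_integral measurableT lI intf derf G0 intG
  Gub).
by apply: eq_Rintegral => y _; rewrite d1E.
Qed.

(** This gives the initial value for the integration: ln (H l) / l is at most the mean of [Z] up to
    a term that vanishes with [l]. *)
Lemma mgf_le_quad l : 0 <= l -> l * M <= 1 ->
  H l <= 1 + l * mean mu Z + (l * M) ^+ 2.
Proof.
move=> l0 lM.
have bq : bounded_meas (fun x => 1 + l * Z x).
  by apply: bounded_measD; [exact: bounded_meas_cst|exact: bounded_measZ].
apply: (@le_trans _ _ (mean mu (fun x => 1 + l * Z x + (l * M) ^+ 2))).
  apply: mean_le => //; first by apply: bounded_measD => //;
    exact: bounded_meas_cst.
  move=> x; have lZ : `|l * Z x| <= l * M by rewrite normrM (ger0_norm l0)
    ler_wpM2l.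
  have := @expR_bernstein R 1 (l * Z x).
  rewrite ler01/= ltr1n => /(_ isT (le_trans (ler_norm _) (le_trans lZ lM))).
  move=> /le_trans; apply; rewrite lerD2l (_ : 2 - 1 = 1 :> R) ?divr1;
    last by lra.
  by rewrite -real_normK ?num_real// lerXn2r// nnegrE// mulr_ge0// ltW.
rewrite meanD ?mean_cst//; last exact: bounded_meas_cst.
rewrite meanD ?mean_cst ?meanZ//; [exact: bounded_meas_cst|exact:
  bounded_measZ].
Qed.

(** The hypothesis [HH1] divided by x^2 H(x) says exactly that the auxiliary function [D] has
    derivative at most 0: the term 2 H1 contributes 3/2 times (ln H)', hence the -3/2. So [D l] is
    at most its limit superior at 0, which the mean of [Z] bounds. *)
Lemma ln_mgf_le l : 0 < l <= 1 / 2 ->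
  ln (H l) <= l / (1 - 3 / 2 * l) * (mean mu Z + 3 / 4 * s * l).
Proof.
move=> /andP[l0 l1].
pose D (x : R) := (x^-1 - 3 / 2) * ln (H x) - 3 / 4 * s * x.
pose D' (x : R) := - x ^- 2 * ln (H x) + (x^-1 - 3 / 2) * (H1 x / H x) - 3 / 4
  * s.
have dD (x : R) : 0 < x -> is_derive x 1 D (D' x).
  move=> x0.
  have dH := is_derive_mgf x.
  have dln : is_derive (H x) 1 (@ln R) (H x)^-1 by apply: is_derive1_ln;
    exact: mgf_gt0.
  have dlnH : is_derive x 1 (fun x => ln (H x)) (H1 x / H x).
    by have := is_derive1_comp dln dH; rewrite mulrC.
  have x_neq0 : x != 0 by rewrite gt_eqF.
  have dinv : is_derive x 1 (fun x : R => x^-1) (- x ^- 2).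
    by apply: is_derive_eq; first exact: is_deriveV;
      rewrite /GRing.scale/= mulr1.
  rewrite /D /D'; apply: is_derive_eq; rewrite /GRing.scale/=.
  by rewrite subr0 mulr1; ring.
have D'0 (x : R) : 0 < x <= 1 / 2 -> D' x <= 0.
  move=> /andP[x0 x1]; have Hx := mgf_gt0 x.
  have := HH1 x; rewrite ltW// x1 => /(_ isT) h.
  have -> : D' x = (x * H1 x - H x * ln (H x) - 3 / 4 * x ^+ 2 * (s * H x + 2 *
    H1 x)) / (x ^+ 2 * H x).
    by rewrite /D'; field; rewrite !gt_eqF.
  by rewrite pmulr_lle0 ?invr_gt0 ?mulr_gt0 ?exprn_gt0// subr_le0.
have Dmono (x0 : R) : 0 < x0 -> x0 < l -> D l <= D x0.
  move=> x00 x0l.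
  apply: (@ler0_derive1_nincr R D x0 l) => //; last by rewrite ltW.
  - move=> x; rewrite in_itv/= => /andP[x0x xl].
    by have := dD x (lt_trans x00 x0x) => ?; exact: ex_derive.
  - move=> x; rewrite in_itv/= => /andP[x0x xl]; have xp := lt_trans x00 x0x.
    rewrite derive1E; have := dD x xp => dDx; rewrite derive_val.
    by apply: D'0; rewrite xp/= (le_trans (ltW xl)).
  - apply: derivable_within_continuous => x; rewrite in_itv/= => /andP[x0x xl].
    by have := dD x (lt_le_trans x00 x0x) => ?; exact: ex_derive.
have DE : D l <= mean mu Z.
  apply/ler_addgt0Pr => e e0.
  (* The three bounds place [x0] below [l], make [mgf_le_quad] applicable, and bring the remainder
     x0 M^2 below [e]. *)
  pose x0 := Num.min (l / 2) (Num.min M^-1 (e / M ^+ 2)).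
  have x00 : 0 < x0 by rewrite !lt_min divr_gt0//= invr_gt0 M0 divr_gt0//
    exprn_gt0.
  have [x0l x0M x0e] : [/\ x0 <= l / 2, x0 <= M^-1 & x0 <= e / M ^+ 2].
    by rewrite !ge_min !lexx ?orbT.
  have x0l' : x0 < l by lra.
  apply: le_trans (Dmono _ x00 x0l') _.
  have x0M' : x0 * M <= 1 by rewrite -ler_pdivlMr// div1r.
  have lnH : ln (H x0) <= x0 * mean mu Z + (x0 * M) ^+ 2.
    have := expR_ge1Dx (ln (H x0)); rewrite lnK ?posrE ?mgf_gt0// => h.
    have := mgf_le_quad x0 (ltW x00) x0M'; lra.
  have c0 : 0 <= x0^-1 - 3 / 2.
    rewrite subr_ge0 -[leLHS]invrK lef_pV2 ?posrE//; lra.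
  have h1 : (x0^-1 - 3 / 2) * ln (H x0) <= (x0^-1 - 3 / 2) * (x0 * mean mu Z +
    (x0 * M) ^+ 2).
    by rewrite ler_wpM2l.
  have h2 : (x0^-1 - 3 / 2) * (x0 * mean mu Z + (x0 * M) ^+ 2)
    <= mean mu Z + x0 * M ^+ 2.
    rewrite (_ : mean mu Z + _ = x0^-1 * (x0 * mean mu Z + (x0 * M) ^+ 2));
      last by field; rewrite gt_eqF.
    rewrite ler_wpM2r ?addr_ge0 ?sqr_ge0 ?mulr_ge0// ?ltW//; lra.
  have h3 : x0 * M ^+ 2 <= e by rewrite -ler_pdivlMr// exprn_gt0.
  have h4 : 0 <= 3 / 4 * s * x0 by rewrite !mulr_ge0// ltW.
  rewrite /D; lra.
have c0 : 0 < 1 - 3 / 2 * l by lra.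
have -> : ln (H l) = l / (1 - 3 / 2 * l) * ((l^-1 - 3 / 2) * ln (H l)).
  by field; apply/andP; split; rewrite gt_eqF//; lra.
apply: ler_wpM2l; first by rewrite divr_ge0 ?(ltW c0) ?(ltW l0).
by rewrite -lerBlDr.
Qed.

(** Chernoff's bound with l = sqrt (t / s) / 2, of the order that balances the quadratic term s l^2
    against t, capped at the largest admissible value 1/2 when s <= t. *)
Lemma concentration_tail (t z : R) : 0 < t ->
  4 * mean mu Z + 4 * Num.sqrt (s * t) + 2 * t <= z ->
  (mu [set x | (z <= Z x)%R] <= (expR (- t))%:E)%E.
Proof.
move=> t0 hz.
suff [l /andP[l0 l1] hl] : exists2 l, 0 < l <= 1 / 2 & ln (H l) - l * z <= - t.
  apply: le_trans (markov_expR mu Z l z bZ (ltW l0)) _.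
  rewrite lee_fin -[X in X * _]lnK ?posrE ?mgf_gt0// -expRD ler_expR.
  exact: hl.
have E0 := EZ0.
have [st|ts] := leP s t.
  exists (1 / 2); first by apply/andP; split; lra.
  have := ln_mgf_le (1 / 2); rewrite lexx andbT => /(_ ltac:(lra)).
  have -> : 1 / 2 / (1 - 3 / 2 * (1 / 2)) = 2 :> R by field.
  have : s <= Num.sqrt (s * t).
    by rewrite -[leLHS]ger0_norm// -sqrtr_sqr ler_wsqrtr// expr2 ler_wpM2l.
  move: s0; lra.
have s0' : 0 < s := lt_trans t0 ts.
pose r := Num.sqrt (t / s).
have r0 : 0 < r by rewrite sqrtr_gt0 divr_gt0.
have r2 : r ^+ 2 * s = t by rewrite sqr_sqrtr ?divr_ge0 ?ltW// divfK// gt_eqF.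
have r1 : r <= 1.
  by rewrite -sqrtr1 ler_wsqrtr// ler_pdivrMr// mul1r ltW.
have rs : Num.sqrt (s * t) = r * s.
  rewrite -r2 mulrCA -expr2 -exprMn sqrtr_sqr ger0_norm// mulr_ge0// ltW//.
exists (r / 2); first by apply/andP; split; lra.
have := ln_mgf_le (r / 2).
have -> : 0 < r / 2 <= 1 / 2 by apply/andP; split; lra.
move=> /(_ isT) /le_trans h; rewrite lerBlDr; apply: h.
have h1 : r / 2 / (1 - 3 / 2 * (r / 2)) <= 2 * r.
  rewrite ler_pdivrMr; last by lra.
  have : 0 <= r * (1 - r) by rewrite mulr_ge0//; lra.
  nra.
have h0 : 0 <= mean mu Z + 3 / 4 * s * (r / 2) by rewrite addr_ge0//
  !mulr_ge0// ?divr_ge0// ltW.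
apply: le_trans (ler_wpM2r h0 h1) _.
have h2 : r / 2 * (4 * mean mu Z + 4 * (r * s) + 2 * t) <= r / 2 * z.
  by rewrite ler_wpM2l -?rs// divr_ge0// ltW.
have h3 : 0 <= r * t by rewrite mulr_ge0// ltW.
have h4 : r * (r * s) = t by rewrite mulrA -expr2.
nra.
Qed.

End herbst.

(** * Talagrand and Bernstein tails under a product law *)

Section tails.
Context {d} {S : measurableType d} {R : realType} (P : probability S R).
Context {n : nat} (mu : probability (n.-tuple S) R).
Context (mu_rect : forall B : 'I_n -> set S, (forall i, measurable (B i)) ->
  mu (rectangle B) = (\prod_(i < n) P (B i))%E).

Lemma supsum_tail (T : set (S -> R)) (v t z : R) :
  T !=set0 -> (forall xi, T xi -> forall s, `|xi s| <= 1) ->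
  (forall xi, T xi -> measurable_fun [set: S] xi) ->
  (forall xi, T xi -> mean P xi = 0) ->
  (forall xi, T xi -> mean P (fun s => xi s ^+ 2) <= v) ->
  (forall a : pred 'I_n, measurable_fun [set: n.-tuple S] (supsum T a)) ->
  0 < t ->
  4 * mean mu (supsum T predT) + 4 * Num.sqrt (n%:R * v * t) + 2 * t <= z ->
  (mu [set x | (z <= supsum T predT x)%R] <= (expR (- t))%:E)%E.
Proof.
move=> T0 T1 mT T_mean T_var mZ t0 hz.
(* The bound on the supremum must be positive even for [n = 0], hence [n.+1]. *)
apply: (concentration_tail mu _ (n%:R * v) n.+1%:R) => //.
- move=> x; apply: le_trans (norm_supsum_le T T0 T1 _ x) _.
  by rewrite ler_nat.
- by rewrite mulr_ge0// (var_ge0 P T v).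
- exact: (mean_supsum_ge0 P mu mu_rect).
move=> l l01.
have := entropy_supsum_le P mu mu_rect T v T0 T1 mT T_mean T_var mZ l l01.
rewrite (_ : mean mu (fun x => _) = l * mean mu (fun x =>
  supsum T predT x * expR (l * supsum T predT x)))//.
rewrite -meanZ; first by congr mean; apply/funext => x; rewrite mulrA.
have bZ := bounded_meas_supsum T T0 T1 mZ predT.
exact/bounded_measM/bounded_meas_expR/bounded_measZ.
Qed.

Lemma mean_prod (u : S -> R) (r : seq 'I_n) : bounded_meas u -> uniq r ->
  bounded_meas (fun x : n.-tuple S => \prod_(j <- r) u (tnth x j)) /\
  mean mu (fun x => \prod_(j <- r) u (tnth x j)) = mean P u ^+ size r.
Proof.
move=> bu.
have bj (j : 'I_n) : bounded_meas (fun x : n.-tuple S => u (tnth x j)).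
  have [mxi [M xiM]] := bu; split; last by exists M.
  by apply: measurableT_comp mxi _; exact: measurable_tnth.
elim: r => [|i r IH] /=.
  split; first by under eq_fun do rewrite big_nil; exact: bounded_meas_cst.
  by under eq_fun do rewrite big_nil; rewrite mean_cst expr0.
move=> /andP[ir /IH[bp mp]]; split.
  by under eq_fun do rewrite big_cons; exact: bounded_measM.
under eq_fun do rewrite big_cons mulrC.
rewrite -(mean_cmean P mu mu_rect i); last exact: bounded_measM.
rewrite cmean_mull//; last first.
  move=> x y; apply: eq_big_seq => j jr; rewrite tnth_upd.
  by case: eqP jr => [->|//]; rewrite (negbTE ir).
rewrite (_ : (fun x => _) = fun x => mean P u * \prod_(j <- r) u (tnth x j)).
  by rewrite meanZ// mp exprS.
apply/funext => x; rewrite mulrC; congr (_ * _).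
by rewrite /cmean; congr mean; apply/funext => y; rewrite tnth_upd eqxx.
Qed.

(** By independence it is enough to treat one factor. There l g <= 2 l < 2, so [expR_bernstein]
    applies with a = 2 l, and the linear term has mean 0. *)
Lemma bernstein_mgf (g : S -> R) (l : R) : bounded_meas g ->
  (forall s, g s <= 2) -> mean P g = 0 -> 0 <= l < 1 ->
  mean mu (fun x => expR (l * \sum_(j < n) g (tnth x j))) <=
  expR (n%:R * (l ^+ 2 * mean P (fun s => g s ^+ 2) / (2 - 2 * l))).
Proof.
move=> bg g2 mg0 /andP[l0 l1].
have bu : bounded_meas (fun s => expR (l * g s)) by
  exact/bounded_meas_expR/bounded_measZ.
have [_ mp] := mean_prod _ (enum 'I_n) bu (enum_uniq _).
rewrite (_ : (fun x => _) = (fun x => \prod_(j <- enum 'I_n) expR (l * g (tnth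
  x j)))); last first.
  by apply/funext => x; rewrite big_enum/= -expR_sum mulr_sumr.
rewrite mp size_enum_ord.
rewrite expRM_natl; apply: lerXn2r; rewrite ?nnegrE ?expR_ge0//.
  by apply: Rintegral_ge0 => x _; exact: expR_ge0.
apply: le_trans (expR_ge1Dx _).
have bq : bounded_meas (fun s => g s ^+ 2) by exact: bounded_measX.
have b1 : bounded_meas (fun s => 1 + l * g s).
  by apply: bounded_measD; [exact: bounded_meas_cst|exact: bounded_measZ].
apply: (@le_trans _ _ (mean P (fun s => 1 + l * g s + (l ^+ 2 / (2 - 2 * l)) *
  g s ^+ 2))).
  apply: mean_le => //; first by apply: bounded_measD => //;
    exact: bounded_measZ.
  move=> s; have := @expR_bernstein R (2 * l) (l * g s).
  have -> : 0 <= 2 * l < 2 by apply/andP; split; lra.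
  rewrite [2 * l]mulrC ler_wpM2l// => /(_ isT isT) /le_trans; apply.
  by rewrite lerD2l exprMn mulrAC [l * 2]mulrC.
rewrite meanD//; last exact: bounded_measZ.
rewrite meanD ?mean_cst ?meanZ//; [|exact: bounded_meas_cst|exact:
  bounded_measZ].
by rewrite mg0 mulr0 addr0 lerD2l mulrAC.
Qed.

Lemma bernstein_tail (g : S -> R) (t x : R) : bounded_meas g ->
  (forall s, g s <= 2) -> mean P g = 0 -> 0 < t ->
  Num.sqrt (2 * t * (n%:R * mean P (fun s => g s ^+ 2))) + t <= x ->
  (mu [set y : n.-tuple S | (x <= \sum_(j < n) g (tnth y j))%R]
    <= (expR (- t))%:E)%E.
Proof.
move=> bg g2 mg0 t0; set V := mean P _ => hx.
have V0 : 0 <= V by apply: Rintegral_ge0 => s _; exact: sqr_ge0.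
have bW : bounded_meas (fun y : n.-tuple S => \sum_(j < n) g (tnth y j)).
  apply: bounded_meas_sum => j _; have [mxi [M xiM]] := bg; split;
    last by exists M.
  by apply: measurableT_comp mxi _; exact: measurable_tnth.
have key l : 0 <= l < 1 ->
    (mu [set y : n.-tuple S | (x <= \sum_(j < n) g (tnth y j))%R] <=
    (expR (n%:R * (l ^+ 2 * V / (2 - 2 * l)) - l * x))%:E)%E.
  move=> l01; have /andP[l0 l1] := l01.
  apply: le_trans (markov_expR mu _ l x bW l0) _.
  by rewrite lee_fin expRD ler_wpM2r ?expR_ge0// bernstein_mgf.
(* Without variance the optimal parameter would be the excluded value l = 1. If the probability r
   exceeded exp(-t), the l for which l t is the midpoint of t and -ln r would give a
   contradiction. *)
have [nV0|nV0] := eqVneq (n%:R * V) 0.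
  move: hx; rewrite nV0 mulr0 sqrtr0 add0r => hx.
  have key' l : 0 <= l < 1 -> (mu [set y : n.-tuple S | (x
    <= \sum_(j < n) g (tnth y j))%R] <= (expR (- (l * t)))%:E)%E.
    move=> l01; apply: le_trans (key l l01) _; rewrite lee_fin ler_expR.
    have /andP[l0 _] := l01.
    have -> : n%:R * (l ^+ 2 * V / (2 - 2 * l)) = n%:R * V * (l ^+ 2 / (2 - 2 *
      l)).
      by ring.
    by rewrite nV0 mul0r sub0r lerN2 ler_wpM2l.
  have mA : measurable [set y : n.-tuple S | (x
    <= \sum_(j < n) g (tnth y j))%R].
    have [mW _] := bW.
    rewrite (_ : [set y | _] = (fun y => \sum_(j < n) g (tnth y j)) @^-1` `[x,
      +oo[).
      by rewrite -[X in measurable X]setTI; apply: mW => //;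
        exact: measurable_itv.
    by apply/seteqP; split => y /=; rewrite in_itv/= andbT.
  have fA : mu [set y : n.-tuple S | (x <= \sum_(j < n) g (tnth y j))%R] \is a
    fin_num.
    exact: fin_num_measure.
  rewrite -(fineK fA) lee_fin.
  have r1 : fine (mu [set y : n.-tuple S | (x
    <= \sum_(j < n) g (tnth y j))%R]) <= 1.
    by rewrite -lee_fin fineK// probability_le1.
  move: key' r1; rewrite -(fineK fA); set r := fine _ => key' r1.
  rewrite leNgt; apply/negP => tr.
  have r0 : 0 < r by exact: lt_trans (expR_gt0 _) tr.
  have lntr : - t < ln r by rewrite -(expRK (- t)) ltr_ln// posrE expR_gt0.
  have lnr0 : ln r <= 0 by rewrite ln_le0.
  pose l := (t - ln r) / (2 * t).
  have l01 : 0 <= l < 1.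
    rewrite /l divr_ge0/=; [|lra|lra].
    rewrite ltr_pdivrMr; lra.
  have := key' l l01; rewrite lee_fin -ler_ln ?posrE ?expR_gt0// expRK.
  have -> : l * t = (t - ln r) / 2 by rewrite /l; field; rewrite gt_eqF.
  lra.
pose p := Num.sqrt (2 * t); pose w := Num.sqrt (n%:R * V).
have w0 : 0 < w by rewrite sqrtr_gt0 lt_neqAle eq_sym nV0/= mulr_ge0.
have p0 : 0 < p by rewrite sqrtr_gt0 mulr_gt0.
have p2 : p ^+ 2 = 2 * t by rewrite sqr_sqrtr// mulr_ge0// ltW.
have w2 : w ^+ 2 = n%:R * V by rewrite sqr_sqrtr// mulr_ge0.
have pw : Num.sqrt (2 * t * (n%:R * V)) = p * w by rewrite sqrtrM// mulr_ge0//
  ltW.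
have pw0 : 0 < w + p by rewrite addr_gt0.
(* With this l the exponent at the threshold p w + p^2 / 2 equals -p^2 / 2 = -t exactly. *)
pose l := p / (w + p).
have l01 : 0 <= l < 1.
  rewrite /l divr_ge0 ?ltW//= ltr_pdivrMr// mul1r; lra.
apply: le_trans (key l l01) _; rewrite lee_fin ler_expR.
have -> : n%:R * (l ^+ 2 * V / (2 - 2 * l)) = w ^+ 2 * l ^+ 2 / (2 - 2 * l).
  by rewrite w2; ring.
have -> : w ^+ 2 * l ^+ 2 / (2 - 2 * l) = w * p ^+ 2 / (2 * (w + p)).
  rewrite /l; field; rewrite !gt_eqF//=; lra.
have : l * (p * w + t) <= l * x by rewrite ler_wpM2l -?pw//; case/andP: l01.
have -> : t = p ^+ 2 / 2 by rewrite p2; field.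
have -> : l * (p * w + p ^+ 2 / 2) = w * p ^+ 2 / (2 * (w + p)) + p ^+ 2 / 2.
  by rewrite /l; field; rewrite !gt_eqF.
lra.
Qed.

End tails.

(** * Transfer to the empirical process of an i.i.d. sample *)

Section sampling.
Context {d} {S : measurableType d} {R : realType} (P : probability S R).
Context {d'} {Omega : measurableType d'} (Pr : probability Omega R).
Context {n : nat} (n_gt0 : (0 < n)%N) (X : 'I_n -> {RV Pr >-> S}).
Context (X_iid : iid P X).

Lemma measurable_sample : measurable_fun [set: Omega] (sample X).
Proof.
apply/measurable_fun_tnthP => i.
by apply: (eq_measurable_fun (X i)) => [w _|//]; rewrite /= tnth_mktuple.
Qed.

Definition sample_law : probability (n.-tuple S) R :=
  distribution Pr (mfun_Sub (mem_set measurable_sample) : {mfun Omega >->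
    n.-tuple S}).

Lemma sample_lawE A : sample_law A = Pr (sample X @^-1` A).
Proof. by []. Qed.

Lemma sample_law_rectangle (B : 'I_n -> set S) : (forall i, measurable (B i)) ->
  sample_law (rectangle B) = (\prod_(i < n) P (B i))%E.
Proof.
move=> mB; have [XP Xprod] := X_iid.
rewrite sample_lawE (_ : _ @^-1` _ = [set w | forall i, B i (X i w)]).
  by rewrite Xprod//; apply: eq_bigr => i _; exact: XP.
apply/seteqP; split => w /= h i; have := h i; by rewrite tnth_mktuple.
Qed.

Lemma mean_sample_law (f : n.-tuple S -> R) : bounded_meas f ->
  mean sample_law f = mean Pr (f \o sample X).
Proof.
move=> bf; rewrite /mean /Rintegral; congr fine.
apply: integral_distribution; first by apply/measurable_EFinP; case: bf.
apply: (bounded_meas_integrable Pr (f \o sample X)); have [mf [M fM]] := bf.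
split; last by exists M => w; exact: fM.
by apply: measurableT_comp => //; exact: measurable_sample.
Qed.

Section class.
Context (H : set (S -> R)) (H_neq0 : H !=set0).
Context (H_meas : forall h, H h -> measurable_fun [set: S] h).
Context (H_le1 : forall h, H h -> forall s, `|h s| <= 1).
Context (H_sym : forall h, H h -> H (fun s => - h s)).
Context (H_class : measurable_class P n H).

(* The factor 1/2 makes these functions bounded by 1. *)
Definition half_centered : set (S -> R) :=
  [set (fun s => 1 / 2 * (h s - mean P h)) | h in H].

Lemma bounded_meas_H h : H h -> bounded_meas h.
Proof. by move=> Hh; split; [exact: H_meas|exists 1; exact: H_le1]. Qed.

Lemma half_centered_neq0 : half_centered !=set0.
Proof. by have [h Hh] := H_neq0; exists (fun s =>
  1 / 2 * (h s - mean P h)), h. Qed.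

Lemma half_centered_le1 xi : half_centered xi -> forall s, `|xi s| <= 1.
Proof.
move=> [h Hh <-] s.
have := mean_norm P h 1 (bounded_meas_H h Hh) (H_le1 h Hh).
have := H_le1 h Hh s; rewrite !ler_norml => /andP[? ?] /andP[? ?].
by apply/andP; split; lra.
Qed.

Lemma bounded_meas_half_centered xi : half_centered xi -> bounded_meas xi.
Proof.
move=> [h Hh <-]; apply: bounded_measZ; apply: bounded_measB.
  exact: bounded_meas_H.
exact: bounded_meas_cst.
Qed.

Lemma half_centered_mean xi : half_centered xi -> mean P xi = 0.
Proof.
move=> [h Hh <-]; have bh := bounded_meas_H h Hh.
rewrite meanZ; last by apply: bounded_measB => //; exact: bounded_meas_cst.
by rewrite meanB ?mean_cst ?subrr ?mulr0//; exact: bounded_meas_cst.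
Qed.

Lemma half_centered_var (v : R) : (forall h, H h -> Var P h <= v) ->
  forall xi, half_centered xi -> mean P (fun s => xi s ^+ 2) <= v / 4.
Proof.
move=> Hv _ [h Hh <-]; have bh := bounded_meas_H h Hh.
have := Hv h Hh; rewrite /Var.
have -> : (fun s => (1 / 2 * (h s - mean P h)) ^+ 2) =
    fun s => 1 / 4 * h s ^+ 2 + (- (mean P h / 2) * h s + mean P h ^+ 2 / 4).
  by apply/funext => s; field.
have b1 : bounded_meas (fun s => 1 / 4 * h s ^+ 2) by
  exact/bounded_measZ/bounded_measX.
have b2 : bounded_meas (fun s => - (mean P h / 2) * h s) by exact:
  bounded_measZ.
have b3 : bounded_meas (fun _ : S => mean P h ^+ 2 / 4) by exact:
  bounded_meas_cst.
rewrite meanD//; last exact: bounded_measD.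
rewrite meanD// mean_cst !meanZ//; last exact: bounded_measX.
nra.
Qed.

(** Symmetry of [H] removes the absolute value. The weights, 1/2 on [a] and 0 elsewhere, are an
    instance of those in [measurable_class]; arbitrary weights there are what makes the suprema
    without one point measurable. *)
Lemma ereal_sup_supsum (a : pred 'I_n) (x : n.-tuple S) :
  ereal_sup [set `|\sum_(i < n) (if a i then 1 / 2 else 0) *
    (h (tnth x i) - mean P h)|%:E | h in H] = (supsum half_centered a x)%:E.
Proof.
have sumE (h : S -> R) : \sum_(i < n) (if a i then 1 / 2 else 0) * (h (tnth x
  i) - mean P h) =
    \sum_(i | a i) (1 / 2 * (h (tnth x i) - mean P h)).
  by rewrite [RHS]big_mkcond; apply: eq_bigr => i _; case: ifP => // _;
    rewrite mul0r.
apply/eqP; rewrite eq_le; apply/andP; split.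
  apply: ge_ereal_sup => _ [h Hh <-]; rewrite lee_fin sumE ler_norml.
  have Hh' := H_sym h Hh.
  have := supsum_ge half_centered half_centered_neq0 half_centered_le1 a x _
    (ex_intro2 _ _ _ Hh erefl).
  have := supsum_ge half_centered half_centered_neq0 half_centered_le1 a x _
    (ex_intro2 _ _ _ Hh' erefl).
  rewrite (_ : mean P (fun s => - h s) = - mean P h); last first.
    have -> : (fun s => - h s) = fun s => -1 * h s by apply/funext => s;
      rewrite mulN1r.
    by rewrite meanZ ?mulN1r//; exact: bounded_meas_H.
  rewrite (_ : \sum_(j | a j) 1 / 2 * (- h (tnth x j) - - mean P h) =
     - \sum_(i | a i) (1 / 2 * (h (tnth x i) - mean P h))); last first.
    by rewrite -sumrN; apply: eq_bigr => i _; ring.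
  by move=> h1 h2; apply/andP; split => //; rewrite lerNl.
apply/lee_addgt0Pr => e e0.
have [_ [h Hh <-] he] :=
  supsum_adherent half_centered half_centered_neq0 half_centered_le1 a x e e0.
rewrite -leeBlDr// -EFinB (le_trans _ (ereal_sup_ubound (ex_intro2 _ _ h Hh
  erefl)))//.
by rewrite lee_fin sumE (le_trans _ (ler_norm _))// ltW.
Qed.

Lemma measurable_supsum_half (a : pred 'I_n) :
  measurable_fun [set: n.-tuple S] (supsum half_centered a).
Proof.
apply/measurable_EFinP.
apply: eq_measurable_fun (H_class (fun i => if a i then 1 / 2 else 0)) => x _.
by rewrite /= ereal_sup_supsum.
Qed.

Lemma ereal_sup_emp (x : n.-tuple S) :
  ereal_sup [set `|emp_mean x h - mean P h|%:E | h in H] =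
  (2 / n%:R * supsum half_centered predT x)%:E.
Proof.
have nR : 0 < n%:R :> R by rewrite ltr0n.
have n2 : 0 < 2 / n%:R :> R by rewrite divr_gt0.
rewrite EFinM -ereal_sup_supsum -ereal_sup_pZl//; congr ereal_sup.
have E (h : S -> R) : `|emp_mean x h - mean P h| = 2 / n%:R *
    `|\sum_(i < n) (if predT i then 1 / 2 else 0) * (h (tnth x i) - mean P h)|.
  rewrite -[in RHS](ger0_norm (ltW n2)) -normrM; congr `|_|.
  rewrite -mulr_sumr big_split/= sumrN sumr_const card_ord /emp_mean -mulr_natl.
  by field; rewrite gt_eqF.
apply/seteqP; split => [_ [h Hh <-]|_ [_ [h Hh <-] <-]]/=.
  exists (`|\sum_(i < n) (if predT i then 1 / 2 else 0) * (h (tnth x i) - mean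
    P h)|%:E).
    by exists h.
  by rewrite -EFinM -E.
by exists h; rewrite // -EFinM -E.
Qed.

(** Halving gives v = sigma^2 / 4 and makes the empirical supremum 2 / n times Z. Multiplied by 2 /
    n, the threshold 4 E Z + 4 sqrt (n v t) + 2 t turns into 4 (phi + sigma sqrt (t / n) + t / n),
    twice the expression in [U_bar]. *)
Lemma sup_emp_tail (phi sigma t z : R) : 0 < t -> 0 <= sigma ->
  (forall h, H h -> Var P h <= sigma ^+ 2) ->
  (\int[Pr]_w ereal_sup [set `|emp_mean (sample X w) h - mean P h|%:E | h in H]
    <= phi%:E)%E ->
  4 * (phi + sigma * Num.sqrt (t / n%:R) + t / n%:R) <= z ->
  (Pr [set w | z%:E <= ereal_sup [set `|emp_mean (sample X w) h - mean P h|%:E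
    | h in H]]
   <= (expR (- t))%:E)%E.
Proof.
move=> t0 sigma0 Hv phiE hz.
have nR : 0 < n%:R :> R by rewrite ltr0n.
have bZ : bounded_meas (supsum half_centered predT : n.-tuple S -> R).
  exact: (bounded_meas_supsum _ half_centered_neq0 half_centered_le1
    measurable_supsum_half).
have phiZ : 2 / n%:R * mean sample_law (supsum half_centered predT) <= phi.
  rewrite -lee_fin; apply: le_trans phiE.
  rewrite -meanZ// mean_sample_law; last exact: bounded_measZ.
  rewrite EFin_mean; last first.
    have [mf [M fM]] := bounded_measZ (2 / n%:R) _ bZ.
    split; last by exists M => w; exact: fM.
    by apply: measurableT_comp mf _; exact: measurable_sample.
  rewrite le_eqVlt; apply/orP; left; apply/eqP; apply: eq_integral => w _.
  by rewrite ereal_sup_emp.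
have tail := supsum_tail P sample_law sample_law_rectangle half_centered
  (sigma ^+ 2 / 4) t (n%:R / 2 * z) half_centered_neq0 half_centered_le1
  (fun xi Txi => (bounded_meas_half_centered xi Txi).1) half_centered_mean
  (half_centered_var _ Hv) measurable_supsum_half t0.
have /tail : 4 * mean sample_law (supsum half_centered predT) +
    4 * Num.sqrt (n%:R * (sigma ^+ 2 / 4) * t) + 2 * t <= n%:R / 2 * z.
  have -> : Num.sqrt (n%:R * (sigma ^+ 2 / 4) * t) = n%:R / 2 * sigma *
    Num.sqrt (t / n%:R).
    have -> : n%:R * (sigma ^+ 2 / 4) * t = (n%:R / 2 * sigma) ^+ 2 * (t /
      n%:R).
      by field; rewrite gt_eqF.
    rewrite sqrtrM ?sqr_ge0// sqrtr_sqr ger0_norm// mulr_ge0// divr_ge0// ltW//.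
  set q := Num.sqrt _.
  have h1 : n%:R / 2 * (4 * (phi + sigma * q + t / n%:R)) <= n%:R / 2 * z.
    by rewrite ler_wpM2l// divr_ge0// ltW.
  have h2 : n%:R / 2 * (2 / n%:R * mean sample_law (supsum half_centered
    predT)) <= n%:R / 2 * phi.
    by rewrite ler_wpM2l// divr_ge0// ltW.
  apply: le_trans h1; move: h2.
  have -> : n%:R / 2 * (2 / n%:R * mean sample_law (supsum half_centered
    predT)) =
      mean sample_law (supsum half_centered predT) by field; rewrite gt_eqF.
  have -> : n%:R / 2 * (4 * (phi + sigma * q + t / n%:R)) =
      4 * (n%:R / 2 * phi) + 4 * (n%:R / 2 * sigma * q) + 2 * t by field;
        rewrite gt_eqF.
  by move=> h2; rewrite !lerD2r ler_wpM2l.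
apply: le_trans; rewrite le_eqVlt sample_lawE; apply/orP; left; apply/eqP;
  congr (Pr _).
apply/seteqP; split => w /=; rewrite ereal_sup_emp lee_fin => hw.
  rewrite -(ler_pM2l (_ : 0 < 2 / n%:R)) ?divr_gt0//; apply: le_trans hw.
  by rewrite le_eqVlt; apply/orP; left; apply/eqP; field; rewrite gt_eqF.
have : 2 / n%:R * (n%:R / 2 * z) <= 2 / n%:R * supsum half_centered predT
  (sample X w).
  by rewrite ler_pM2l// divr_gt0.
by apply: le_trans; rewrite le_eqVlt; apply/orP; left; apply/eqP; field;
  rewrite gt_eqF.
Qed.

End class.

Lemma emp_bernstein (h : S -> R) (t z : R) : bounded_meas h ->
  (forall s, `|h s| <= 1) ->
  0 < t -> Num.sqrt (2 * t * Var P h / n%:R) + t / n%:R <= z ->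
  (Pr [set w | (z <= emp_mean (sample X w) h - mean P h)%R]
    <= (expR (- t))%:E)%E.
Proof.
move=> bh h1 t0 hz.
have nR : 0 < n%:R :> R by rewrite ltr0n.
have bg : bounded_meas (fun s => h s - mean P h).
  by apply: bounded_measB => //; exact: bounded_meas_cst.
have gv := Var_center P h bh.
have tail := bernstein_tail P sample_law sample_law_rectangle _ t (n%:R * z) bg.
have g2 s : h s - mean P h <= 2.
  have := mean_norm P h 1 bh h1; have := h1 s.
  rewrite !ler_norml => /andP[? ?] /andP[? ?]; lra.
have mg0 : mean P (fun s => h s - mean P h) = 0.
  by rewrite meanB ?mean_cst ?subrr//; exact: bounded_meas_cst.
have /(tail g2 mg0 t0) : Num.sqrt (2 * t * (n%:R * mean P (fun s =>
  (h s - mean P h) ^+ 2))) + t <= n%:R * z.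
  rewrite gv.
  have -> : 2 * t * (n%:R * Var P h) = n%:R ^+ 2 * (2 * t * Var P h / n%:R).
    by field; rewrite gt_eqF.
  rewrite sqrtrM ?sqr_ge0// sqrtr_sqr ger0_norm ?(ltW nR)//.
  have := ler_wpM2l (ltW nR) hz.
  by rewrite mulrDr [n%:R * (t / _)]mulrC divfK ?gt_eqF.
have sE w : \sum_(j < n) (h (tnth (sample X w) j) - mean P h) =
    n%:R * (emp_mean (sample X w) h - mean P h).
  rewrite /emp_mean mulrBr mulVKf ?gt_eqF// big_split/= sumrN sumr_const
    card_ord.
  by rewrite mulr_natl.
apply: le_trans; rewrite le_eqVlt sample_lawE; apply/orP; left; apply/eqP;
  congr (Pr _).
by apply/seteqP; split => w /=; rewrite sE ler_pM2l.
Qed.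

End sampling.

(** * Localization *)

Lemma bounded_meas_Lfun2 {d} {S : measurableType d} {R : realType}
    (P : probability S R) (f : S -> R) : bounded_meas f -> f \in Lfun P 2%:E.
Proof.
move=> bf; rewrite inE/=; apply/andP; split; rewrite inE//=; first by case: bf.
rewrite /finite_norm unlock poweR_lty//.
rewrite (eq_integral (fun x => (f x ^+ 2)%:E)) => [|x _]; last first.
  by rewrite /= powR_mulrn// real_normK// num_real.
apply: (integrable_lty measurableT).
exact: bounded_meas_integrable (bounded_measX f bf).
Qed.

Section delta.
Context {R : realType} (q : R) (q_gt1 : 1 < q).

Lemma delta_gt0 (j : int) : 0 < delta_ q j.
Proof. by rewrite /delta_ exprz_gt0// (lt_trans ltr01). Qed.

Lemma deltaS (j : int) : delta_ q (j + 1) = delta_ q j / q.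
Proof.
have q0 : q != 0 by rewrite gt_eqF// (lt_trans ltr01).
by rewrite /delta_ opprD expfzDr// expN1r.
Qed.

Lemma delta0 : delta_ q 0 = 1. Proof. by rewrite /delta_ oppr0 expr0z. Qed.

Lemma delta_nincr (i j : int) : i <= j -> delta_ q j <= delta_ q i.
Proof.
by move=> ij; rewrite /delta_ ler_eXz2l// lerN2.
Qed.

Lemma delta_expR (j : int) : delta_ q j = expR (- j%:~R * ln q).
Proof.
have q0 : 0 < q by rewrite (lt_trans ltr01).
rewrite /delta_ -powR_intmul ?(ltW q0)// /powR gt_eqF//.
by rewrite mulrNz.
Qed.

Lemma delta_bracket (x : R) : 0 < x ->
  exists j : int, delta_ q (j + 1) < x <= delta_ q j.
Proof.
move=> x0; have lq0 : 0 < ln q by rewrite ln_gt0.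
exists (Num.floor (- ln x / ln q)).
have := floor_itv (- ln x / ln q).
set j := Num.floor _ => /andP[h1 h2].
rewrite !delta_expR -{1 2}(lnK (x := x)) ?posrE//.
rewrite ltr_expR ler_expR.
rewrite ler_pdivlMr// in h1; rewrite ltr_pdivrMr// in h2.
by apply/andP; split; lra.
Qed.

End delta.

(** * Localization of empirical minimizers in one class *)

Section local.
Context {d} {S : measurableType d} {R : realType} (P : probability S R).
Context {d'} {Omega : measurableType d'} (Pr : probability Omega R).
Context {n : nat} (n_gt0 : (0 < n)%N) (X : 'I_n -> {RV Pr >-> S}).
Context (X_iid : iid P X) (q : R) (q_gt1 : 1 < q).
Context (rho : (S -> R) -> (S -> R) -> R).
Context (rho_ge0 : forall f g : S -> R,
  f \in Lfun P 2%:E -> g \in Lfun P 2%:E -> 0 <= rho f g).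
Context (rho_var : forall f g : S -> R,
  f \in Lfun P 2%:E -> g \in Lfun P 2%:E ->
  mean P (fun x => (f x - g x) ^+ 2) - mean P (fun x => f x - g x) ^+ 2
    <= rho f g ^+ 2).
Context (G : set (S -> R)) (G_neq0 : G !=set0).
Context (G_meas : forall f, G f -> measurable_fun [set: S] f).
Context (G_01 : forall f, G f -> forall x, 0 <= f x <= 1).
Context (G_class : forall delta : R, 0 < delta ->
  measurable_class P n (diff_class (min_set P G delta))).
Context (t : R) (t_gt0 : 0 < t).

Lemma bounded_meas_G f : G f -> bounded_meas f.
Proof.
move=> Gf; split; first exact: G_meas.
by exists 1 => x; have /andP[f0 f1] := G_01 f Gf x; rewrite ger0_norm.
Qed.

Lemma mean_G f : G f -> 0 <= mean P f <= 1.
Proof.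
move=> Gf; have bf := bounded_meas_G f Gf.
apply/andP; split; [rewrite -(mean_cst P 0)|rewrite -(mean_cst P 1)];
  apply: mean_le => //; try exact: bounded_meas_cst;
  by move=> x; have /andP[] := G_01 f Gf x.
Qed.

Lemma emp_mean_G f x : G f -> 0 <= emp_mean (x : n.-tuple S) f <= 1.
Proof.
move=> Gf; rewrite /emp_mean mulr_ge0 ?invr_ge0 ?sumr_ge0//=; last first.
  by move=> i _; have /andP[] := G_01 f Gf (tnth x i).
rewrite mulrC ler_pdivrMr ?ltr0n// mul1r.
apply: (@le_trans _ _ (\sum_(i < n) 1)); last by rewrite sumr_const card_ord.
by apply: ler_sum => i _; have /andP[] := G_01 f Gf (tnth x i).
Qed.

Lemma emp_meanB (x : n.-tuple S) (f g : S -> R) :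
  emp_mean x (fun s => f s - g s) = emp_mean x f - emp_mean x g.
Proof. by rewrite /emp_mean big_split/= sumrN mulrBr. Qed.

Let has_inf_risk : has_inf [set mean P g | g in G].
Proof.
split; first by have [g Gg] := G_neq0; exists (mean P g), g.
by exists 0 => _ [g Gg <-]; have /andP[] := mean_G g Gg.
Qed.

Lemma inf_risk_le f : G f -> inf_risk P G <= mean P f.
Proof. by move=> Gf; apply: ge_inf; [case: has_inf_risk|exists f]. Qed.

Lemma inf_risk_adherent e : 0 < e ->
  exists2 g, G g & mean P g < inf_risk P G + e.
Proof.
by move=> e0; have [_ [g Gg <-] ?] := inf_adherent e0 has_inf_risk; exists g.
Qed.

Lemma inf_risk_ge0 : 0 <= inf_risk P G.
Proof.
apply: lb_le_inf; first by case: has_inf_risk.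
by move=> _ [g Gg <-]; have /andP[] := mean_G g Gg.
Qed.

Definition emp_sup (delta : R) (x : n.-tuple S) : \bar R :=
  ereal_sup [set `|emp_mean x h - mean P h|%:E
            | h in diff_class (min_set P G delta)].

Section diff.
Context (delta : R) (delta0 : 0 < delta).
Let H := diff_class (min_set P G delta).

Lemma diff_neq0 : H !=set0.
Proof.
have [g Gg gd] := inf_risk_adherent delta delta0.
have mg : min_set P G delta g.
  by split => //; rewrite /excess_risk lerBlDl ltW.
by exists (fun s => g s - g s), g => //; exists g.
Qed.

Lemma diff_meas h : H h -> measurable_fun [set: S] h.
Proof.
move=> [f [Gf _] [g [Gg _] <-]].
by have [] := bounded_measB f g (bounded_meas_G f Gf) (bounded_meas_G g Gg).
Qed.

Lemma diff_le1 h : H h -> forall s, `|h s| <= 1.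
Proof.
move=> [f [Gf _] [g [Gg _] <-]] s.
have /andP[? ?] := G_01 f Gf s; have /andP[? ?] := G_01 g Gg s.
by rewrite ler_norml; apply/andP; split; lra.
Qed.

Lemma diff_sym h : H h -> H (fun s => - h s).
Proof.
move=> [f Gf [g Gg <-]]; exists g => //; exists f => //.
by apply/funext => s; rewrite opprB.
Qed.

Lemma measurable_emp_sup_event (z : R) :
  measurable [set w | (z%:E <= emp_sup delta (sample X w))%E].
Proof.
rewrite /emp_sup.
under eq_set do rewrite (ereal_sup_emp P n_gt0 _ diff_neq0 diff_meas diff_le1
  diff_sym) lee_fin.
have mZ : measurable_fun [set: Omega] (fun w =>
  2 / n%:R * supsum (half_centered P H) predT (sample X w)).
  apply: measurable_funM; first exact: measurable_cst.
  have mS := measurable_supsum_half P H diff_neq0 diff_meas diff_le1 diff_sym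
    (G_class delta delta0) predT.
  exact: (measurableT_comp mS (measurable_sample Pr X)).
rewrite (_ : [set w | _] = (fun w => 2 / n%:R * supsum (half_centered P H)
  predT (sample X w)) @^-1` `[z, +oo[).
  by rewrite -[X in measurable X]setTI; apply: mZ => //; exact: measurable_itv.
by apply/seteqP; split => w /=; rewrite in_itv/= andbT.
Qed.

(** If [phi_n] or [D_P] were infinite, so would be [U_bar]; hence both are real here, and the square
    of [D_P] bounds the variance of every difference through [rho]. *)
Lemma emp_sup_tail (c : R) :
  (U_bar P X rho G t delta <= c%:E)%E ->
  (Pr [set w | (2 * c)%:E <= emp_sup delta (sample X w)] <= (expR (- t))%:E)%E.
Proof.
rewrite /U_bar.
have nR : 0 < n%:R :> R by rewrite ltr0n.
have tn0 : 0 < t / n%:R by rewrite divr_gt0.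
have phi0 : (0 <= phi_n P X G delta)%E.
  apply: integral_ge0 => w _; have [h Hh] := diff_neq0.
  by apply: le_trans (ereal_sup_ubound (ex_intro2 _ _ h Hh erefl));
    rewrite lee_fin.
have rhoD f g : min_set P G delta f -> min_set P G delta g ->
    0 <= rho f g /\ ((rho f g)%:E <= D_P P rho G delta)%E.
  move=> Gf Gg; split; first by
    apply: rho_ge0; apply/bounded_meas_Lfun2/bounded_meas_G;
      [case: Gf|case: Gg].
  by apply: ereal_sup_ubound; exists f => //; exists g.
have D0 : (0 <= D_P P rho G delta)%E.
  have [_ [f Gf [g Gg _]]] := diff_neq0; have [r0 rD] := rhoD f g Gf Gg.
  by apply: le_trans rD; rewrite lee_fin.
case phiE : (phi_n P X G delta) phi0 => [phi| |]// phi0; last first.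
  have Dt : (0 <= D_P P rho G delta * (Num.sqrt (t / n%:R))%:E)%E.
    by rewrite mule_ge0// lee_fin sqrtr_ge0.
  rewrite -addeA addye; first by rewrite gt0_muley ?lte_fin.
  by rewrite -ltNye (lt_le_trans (ltNyr 0))// adde_ge0// lee_fin ltW.
have st0 : 0 < Num.sqrt (t / n%:R) by rewrite sqrtr_gt0.
case DE : (D_P P rho G delta) D0 rhoD => [D| |]// D0 rhoD; last first.
  by rewrite gt0_mulye ?lte_fin//= gt0_muley ?lte_fin.
rewrite -[(D%:E * _)%E]EFinM -[(phi%:E + _)%E]EFinD -EFinD -EFinM lee_fin => hU.
apply: (sup_emp_tail P Pr n_gt0 X X_iid H diff_neq0 diff_meas diff_le1 diff_sym
  (G_class delta delta0) phi D t) => //; last by lra.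
- move=> _ [f Gf [g Gg <-]]; have [r0 rD] := rhoD f g Gf Gg.
  have Lf : f \in Lfun P 2%:E by apply/bounded_meas_Lfun2/bounded_meas_G;
    case: Gf.
  have Lg : g \in Lfun P 2%:E by apply/bounded_meas_Lfun2/bounded_meas_G;
    case: Gg.
  by apply: le_trans (rho_var f g Lf Lg) _; rewrite lerXn2r.
- by rewrite -phiE.
Qed.

(** The source of all lower bounds on levels: being at most delta / (2 q^3) forces delta to be of
    order t / n at least. *)
Lemma U_bar_ge : ((2 * (t / n%:R))%:E <= U_bar P X rho G t delta)%E.
Proof.
rewrite /U_bar EFinM lee_pmul2l//.
apply: leeDr; apply: adde_ge0.
  apply: integral_ge0 => w _; have [h Hh] := diff_neq0.
  by apply: le_trans (ereal_sup_ubound (ex_intro2 _ _ h Hh erefl));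
    rewrite lee_fin.
apply: mule_ge0; last by rewrite lee_fin sqrtr_ge0.
have [_ [f Gf [g Gg _]]] := diff_neq0.
apply: (@le_trans _ _ (rho f g)%:E).
  rewrite lee_fin; apply: rho_ge0; apply/bounded_meas_Lfun2/bounded_meas_G;
    [by case: Gf|by case: Gg].
by apply: ereal_sup_ubound; exists f => //; exists g.
Qed.

End diff.

Let c : R := 1 / (2 * q ^+ 3).
Let U := U_bar P X rho G t.

Let q_gt0 : 0 < q. Proof. exact: lt_trans ltr01 q_gt1. Qed.

Let c_gt0 : 0 < c.
Proof. by rewrite divr_gt0// mulr_gt0// exprn_gt0. Qed.

Lemma flat_tr_le delta (j : int) : (flat_tr q U delta <= c%:E)%E ->
  delta <= delta_ q j -> (U (delta_ q j) <= (c * delta_ q j)%:E)%E.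
Proof.
move=> h dj; have dj0 := delta_gt0 q q_gt1 j.
rewrite EFinM -lee_pdivrMr//; apply: le_trans h; apply: ereal_sup_ubound.
by exists j.
Qed.

Lemma U_level_ge delta : 0 < delta -> (U delta <= (c * delta)%:E)%E ->
  4 * q ^+ 3 * (t / n%:R) <= delta.
Proof.
move=> d0 /(le_trans (U_bar_ge delta d0)); rewrite lee_fin /c.
have q3 : 0 < q ^+ 3 by rewrite exprn_gt0.
rewrite mul1r [leRHS]mulrC ler_pdivlMr ?mulr_gt0//; lra.
Qed.

Lemma flat_tr_ge delta : 0 < delta -> (flat_tr q U delta <= c%:E)%E ->
  4 * (t / n%:R) <= delta.
Proof.
move=> d0 h; have [j /andP[j1 j2]] := delta_bracket q q_gt1 delta d0.
have := U_level_ge _ (delta_gt0 q q_gt1 j) (flat_tr_le _ _ h j2).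
move: j1; rewrite deltaS// ltr_pdivrMr// => j1 j3.
have tn0 : 0 < t / n%:R by rewrite divr_gt0// ltr0n.
have : 4 * q ^+ 3 * (t / n%:R) < delta * q by exact: le_lt_trans j1.
rewrite (_ : 4 * q ^+ 3 * _ = 4 * q ^+ 2 * (t / n%:R) * q); last by ring.
rewrite ltr_pM2r// => /ltW; apply: le_trans.
rewrite ler_wpM2r ?(ltW tn0)// ler_peMr// exprn_ege1// ltW//.
Qed.

Section localize.
Context (x : n.-tuple S) (fh : S -> R) (G_fh : G fh).
Context (fh_min : forall f, G f -> emp_mean x fh <= emp_mean x f).
Context (good : forall i : nat, (U (delta_ q i) <= (c * delta_ q i)%:E)%E ->
  (emp_sup (delta_ q i) x < (2 * (c * delta_ q i))%:E)%E).

(** The deviation allowed at level i is 2 c delta_i = delta_i / q^3, which is at most delta_i / q,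
    the next level. *)
Let good_diff (i : nat) f g : (U (delta_ q i) <= (c * delta_ q i)%:E)%E ->
  min_set P G (delta_ q i) f -> min_set P G (delta_ q i) g ->
  mean P f - mean P g <= emp_mean x f - emp_mean x g + delta_ q (i%:Z + 1).
Proof.
move=> Ui Gf Gg.
have bf := bounded_meas_G f Gf.1; have bg := bounded_meas_G g Gg.1.
have : (`|emp_mean x (fun s => f s - g s) - mean P (fun s => f s - g s)|%:E <
    (2 * (c * delta_ q i))%:E)%E.
  apply: le_lt_trans (good i Ui); apply: ereal_sup_ubound.
  exists (fun s => f s - g s) => //; exists f => //; exists g => //.
rewrite lte_fin emp_meanB meanB// => h.
have : 2 * (c * delta_ q i) <= delta_ q (i%:Z + 1).
  rewrite deltaS// /c.
  have -> : 2 * (1 / (2 * q ^+ 3) * delta_ q i) = delta_ q i / q ^+ 3.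
    by field; rewrite gt_eqF.
  rewrite ler_wpM2l ?(ltW (delta_gt0 q q_gt1 i))// lef_pV2 ?posrE ?exprn_gt0//.
  by rewrite exprS ler_peMr ?(ltW q_gt0)// exprn_ege1// ltW.
move: h; rewrite ltr_norml => /andP[h1 h2] h3; lra.
Qed.

(** Induction on the level, starting at delta_0 = 1, where the claim holds because all risks lie in
    [0, 1]. Each step compares [fh] with a near-minimizer of the same level. *)
Let risk_le (m : nat) :
  (forall i : nat, (i < m)%N -> (U (delta_ q i) <= (c * delta_ q i)%:E)%E) ->
  mean P fh - inf_risk P G <= delta_ q m.
Proof.
elim: m => [|m IH] Um.
  rewrite delta0; have /andP[_ h1] := mean_G fh G_fh.
  by have := inf_risk_ge0; lra.
have hm : mean P fh - inf_risk P G <= delta_ q m.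
  by apply: IH => i im; apply: Um; rewrite ltnS ltnW.
apply/ler_addgt0Pr => e e0.
pose z := Num.min e (delta_ q m).
have z0 : 0 < z by rewrite lt_min e0 delta_gt0.
have [g Gg gz] := inf_risk_adherent z z0.
have [ze zd] : z <= e /\ z <= delta_ q m by rewrite !ge_min !lexx orbT.
have mg : min_set P G (delta_ q m) g by split => //; rewrite /excess_risk; lra.
have := good_diff m fh g (Um m (ltnSn m)) (conj G_fh hm) mg.
have := fh_min g Gg; rewrite [m.+1%:Z]intS [1 + m%:Z]addrC; lra.
Qed.

(** Let delta_(j+1) < delta <= delta_j. The levels 0, ..., j all satisfy the bound on [U_bar], so
    [risk_le] descends to delta_(j+1); for j < 0 one has delta > 1 and nothing to prove beyond the
    range of the functions. For the second claim [g] belongs to level j because eta <= t / n <=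
    delta_j. *)
Lemma localization delta : 0 < delta -> (flat_tr q U delta <= c%:E)%E ->
  mean P fh - inf_risk P G <= delta /\
  forall g eta, G g -> mean P g <= inf_risk P G + eta -> eta <= t / n%:R ->
    emp_mean x g - emp_mean x fh <= delta + eta.
Proof.
move=> d0 h; have [j /andP[j1 j2]] := delta_bracket q q_gt1 delta d0.
have tn0 : 0 < t / n%:R by rewrite divr_gt0// ltr0n.
have [j0|j0] := leP 0 j; last first.
  have d1 : 1 < delta.
    apply: le_lt_trans j1; rewrite -(delta0 q); apply: delta_nincr => //.
    by rewrite -ltzD1 ltrD2r.
  have /andP[_ h1] := mean_G fh G_fh; have h0 := inf_risk_ge0.
  split; first lra.
  move=> g eta Gg hg _; have /andP[_ g1] := emp_mean_G g x Gg.
  have /andP[f0 _] := emp_mean_G fh x G_fh; have := inf_risk_le g Gg; lra.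
case: j j0 j1 j2 => // m _ j1 j2.
have Um (i : nat) : (i <= m)%N -> (U (delta_ q i) <= (c * delta_ q i)%:E)%E.
  by move=> im; apply: flat_tr_le h _; apply: le_trans j2 _; exact: delta_nincr.
have r1 := risk_le m.+1 Um.
have r0 := risk_le m (fun i im => Um i (ltnW im)).
have mE : delta_ q m.+1 < delta by rewrite intS addrC.
split; first by apply: ltW; exact: le_lt_trans r1 mE.
move=> g eta Gg hg etat.
have U4 := U_level_ge _ (delta_gt0 q q_gt1 m) (Um m (leqnn m)).
have q3 : 1 <= q ^+ 3 by rewrite exprn_ege1// ltW.
have : t / n%:R <= delta_ q m.
  apply: le_trans U4; rewrite ler_peMl ?(ltW tn0)//; lra.
move=> td; have mg : min_set P G (delta_ q m) g.
  by split => //; rewrite /excess_risk; lra.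
have := good_diff m fh g (Um m (leqnn m)) (conj G_fh r0) mg.
have := inf_risk_le fh G_fh; move: mE; rewrite intS [1 + m%:Z]addrC; lra.
Qed.

Lemma localization_bar (dh : R) : (delta_bar P X rho q G t <= dh%:E)%E ->
  mean P fh - inf_risk P G <= dh /\
  forall g eta, G g -> mean P g <= inf_risk P G + eta -> eta <= t / n%:R ->
    emp_mean x g - emp_mean x fh <= dh + eta.
Proof.
rewrite /delta_bar /sharp_tr => hd; split.
  rewrite -lee_fin; apply: le_trans hd; apply: le_ereal_inf_tmp.
  by move=> _ [delta [d0 fd] <-]; rewrite lee_fin;
    have [] := localization delta d0 fd.
move=> g eta Gg hg et; rewrite -lerBlDr -lee_fin; apply: le_trans hd.
apply: le_ereal_inf_tmp => _ [delta [d0 fd] <-]; rewrite lee_fin lerBlDr.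
by have [_] := localization delta d0 fd; exact.
Qed.

End localize.

Lemma delta_bar_ge (dh : R) : (delta_bar P X rho q G t <= dh%:E)%E ->
  4 * (t / n%:R) <= dh.
Proof.
move=> hd; rewrite -lee_fin; apply: le_trans hd; apply: le_ereal_inf_tmp.
by move=> _ [delta [d0 fd] <-]; rewrite lee_fin; exact: flat_tr_ge.
Qed.

End local.

(** * The oracle inequality *)

Section bad_event.
Context {d} {S : measurableType d} {R : realType} (P : probability S R).
Context {d'} {Omega : measurableType d'} (Pr : probability Omega R).
Context {n : nat} (n_gt0 : (0 < n)%N) (X : 'I_n -> {RV Pr >-> S}).
Context (X_iid : iid P X) (q : R) (q_gt1 : 1 < q).
Context (rho : (S -> R) -> (S -> R) -> R).
Context (rho_ge0 : forall f g : S -> R,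
  f \in Lfun P 2%:E -> g \in Lfun P 2%:E -> 0 <= rho f g).
Context (rho_var : forall f g : S -> R,
  f \in Lfun P 2%:E -> g \in Lfun P 2%:E ->
  mean P (fun x => (f x - g x) ^+ 2) - mean P (fun x => f x - g x) ^+ 2
    <= rho f g ^+ 2).
Context (G : set (S -> R)) (G_neq0 : G !=set0).
Context (G_meas : forall f, G f -> measurable_fun [set: S] f).
Context (G_01 : forall f, G f -> forall x, 0 <= f x <= 1).
Context (G_class : forall delta : R, 0 < delta ->
  measurable_class P n (diff_class (min_set P G delta))).
Context (t : R) (t_gt0 : 0 < t).
Context (fstar : S -> R) (fstar_meas : measurable_fun [set: S] fstar).
Context (fstar_01 : forall x, 0 <= fstar x <= 1).
Context (fstar_min : forall f, G f -> mean P fstar <= mean P f).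
Context (phi : R -> R) (phi_nondecr : forall u v : R, 0 <= u -> u <= v ->
  phi u <= phi v).
Context (phi_0 : phi 0 = 0).
Context (phi_submul : forall u v : R, 0 <= u -> 0 <= v ->
  phi (u * v) <= phi u * phi v).
Context (phi_link : forall f, G f ->
  phi (Num.sqrt (Var P (fun x => f x - fstar x))) <= mean P f - mean P fstar).
Context (eps : R) (eps_gt0 : 0 < eps) (phi_eps_lt1 : phi (Num.sqrt eps) < 1).
Context (fh : n.-tuple S -> (S -> R)) (fh_in : forall w, G (fh (sample X w))).
Context (fh_min : forall w f, G f ->
  emp_mean (sample X w) (fh (sample X w)) <= emp_mean (sample X w) f).
Context (dh : n.-tuple S -> R) (dh_meas : measurable_fun [set: n.-tuple S] dh).
Context (dt p : R).
Context (dh_dt : ((1 - p)%:E <=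
  Pr [set w | delta_bar P X rho q G t <= (dh (sample X w))%:E <= dt%:E])%E).

Let phe := phi (Num.sqrt eps).

Let phe_ge0 : 0 <= phe.
Proof. by rewrite -phi_0; apply: phi_nondecr => //; exact: sqrtr_ge0. Qed.

Let c : R := 1 / (2 * q ^+ 3).
Let Delta := [set w | (delta_bar P X rho q G t <= (dh (sample X w))%:E
  <= dt%:E)%E].

Let nR : 0 < n%:R :> R. Proof. by rewrite ltr0n. Qed.

Let tn0 : 0 < t / n%:R. Proof. by rewrite divr_gt0. Qed.

Let mDelta : measurable Delta.
Proof.
have mf : measurable_fun [set: Omega] (fun w => (dh (sample X w))%:E).
  apply/measurable_EFinP; exact: (measurableT_comp dh_meas (measurable_sample
    Pr X)).
rewrite (_ : Delta = (fun w => (dh (sample X w))%:E) @^-1` `[delta_bar P X rho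
  q G t, dt%:E]).
  by rewrite -[X in measurable X]setTI; apply: mf => //; exact: emeasurable_itv.
by apply/seteqP; split => w /=; rewrite in_itv.
Qed.

Let Pr_DeltaC : (Pr (~` Delta) <= p%:E)%E.
Proof.
rewrite probability_setC// leeBlDr; last by rewrite fin_num_measure.
by rewrite addeC -leeBlDr// -EFinB.
Qed.

(* The term [t / n] on the left is a slack that does not depend on [w]; it makes
   the final comparison strict, as the closed event of the theorem requires. *)
Definition excess_bounds (w : Omega) : Prop :=
  dh (sample X w) <= dt /\
  forall cj, conjugate phi (Num.sqrt (2 * t / (eps * n%:R))) = cj%:E ->
   (1 - phe) * (mean P (fh (sample X w)) - mean P fstar) + t / n%:R <=
     emp_mean (sample X w) (fh (sample X w)) - emp_mean (sample X w) fstar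
     + A_const phi eps * dh (sample X w) + cj + t / n%:R /\
   emp_mean (sample X w) (fh (sample X w)) - emp_mean (sample X w) fstar <=
     (1 + phe) * (inf_risk P G - mean P fstar) + cj + t / n%:R.

Lemma conjugate_ge u v : 0 <= u -> ((u * v - phi u)%:E <= conjugate phi v)%E.
Proof. by move=> u0; apply: ereal_sup_ubound; exists u. Qed.

Let conj_ge0 v cj : conjugate phi v = cj%:E -> 0 <= cj.
Proof.
move=> h; rewrite -lee_fin -h; apply: le_trans (conjugate_ge 0 v (lexx _)).
by rewrite mul0r phi_0 subrr.
Qed.

Let bfstar : bounded_meas fstar.
Proof. by split => //; exists 1 => x; have /andP[? ?] := fstar_01 x;
  rewrite ger0_norm. Qed.

(** Here t / n > 1, so [dh] exceeds 4 while all risks lie in [0, 1]. No deviation inequality enters,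
    which matters because the logarithm in the probability bound may vanish. *)
Lemma excess_bounds_large_t w : n%:R < t -> Delta w -> excess_bounds w.
Proof.
move=> nt /andP[hd1]; rewrite lee_fin => hd2; split=> // cj hcj.
have tn1 : 1 < t / n%:R by rewrite ltr_pdivlMr// mul1r.
have := delta_bar_ge P Pr n_gt0 X q q_gt1 rho rho_ge0 G G_neq0 G_meas G_01 t
  t_gt0 _ hd1.
set x := sample X w; move=> hd.
have cj0 := conj_ge0 _ _ hcj.
have G_star : [set fstar] fstar by [].
have [M1 M2] : mean P (fh x) <= 1 /\ 0 <= mean P fstar.
  by have /andP[? ?] := mean_G P G G_meas G_01 _ (fh_in w);
    have /andP[? ?] := mean_G P [set fstar] (fun f e =>
      eq_ind_r _ fstar_meas e) (fun f e => eq_ind_r (fun f => forall x, 0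
        <= f x <= 1) fstar_01 e) _ G_star.
have /andP[e1 e2] := emp_mean_G n_gt0 G G_01 _ x (fh_in w).
have /andP[e3 e4] := emp_mean_G n_gt0 [set fstar] (fun f e =>
  eq_ind_r (fun f => forall x, 0 <= f x <= 1) fstar_01 e) _ x G_star.
have a0 : mean P fstar <= inf_risk P G.
  by apply: lb_le_inf => [|_ [g Gg <-]]; [have [g Gg] := G_neq0;
    exists (mean P g), g|exact: fstar_min].
have p0 := phe_ge0; have p1 : phe < 1 by exact: phi_eps_lt1.
split; last first.
  have : 0 <= (1 + phe) * (inf_risk P G - mean P fstar) by rewrite mulr_ge0;
    lra.
  lra.
have : (1 - phe) * (mean P (fh x) - mean P fstar) <= 1.
  have : (1 - phe) * (mean P (fh x) - mean P fstar)
    <= (1 - phe) * 1 by rewrite ler_wpM2l; lra.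
  lra.
have : 3 / 2 * 4 <= A_const phi eps * dh x.
  by rewrite ler_pM//; rewrite /A_const -/phe; lra.
lra.
Qed.

(** Origin of 5/2 - phe: a multiple 1 - phe of [dh] for the risk of [fh], one [dh] for the empirical
    excess of [fb], and half a [dh], at least 2 t / n, which covers t' / n + eta. *)
Lemma excess_bounds_main w (fb : S -> R) (t' : R) : 0 < t' -> t' < t -> G fb ->
  mean P fb <= inf_risk P G + (t - t') / (2 * n%:R) ->
  Delta w ->
  (forall i : nat,
    (U_bar P X rho G t (delta_ q i) <= (c * delta_ q i)%:E)%E ->
    (emp_sup P G (delta_ q i) (sample X w) < (2 * (c * delta_ q i))%:E)%E) ->
  (let h := fun s => fb s - fstar s in
   `|emp_mean (sample X w) h - mean P h| <
    Num.sqrt (2 * t' * Var P h / n%:R) + t' / n%:R) ->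
  excess_bounds w.
Proof.
move=> t'0 t't Gfb hfb /andP[hd1 hd2] good hbern; split;
  first by rewrite -lee_fin.
move=> cj hcj; set x := sample X w in good hbern hd1 hd2 *.
have bfb : bounded_meas fb by exact: bounded_meas_G G_meas G_01 _ Gfb.
have [E1 E2] := localization_bar P Pr n_gt0 X q q_gt1 rho rho_ge0 G G_neq0
  G_meas G_01
  t t_gt0 x (fh x) (fh_in w) (fh_min w) good _ hd1.
have hd := delta_bar_ge P Pr n_gt0 X q q_gt1 rho rho_ge0 G G_neq0 G_meas G_01 t
  t_gt0 _ hd1.
pose eta := (t - t') / (2 * n%:R).
have etaE : 2 * eta = t / n%:R - t' / n%:R by rewrite /eta; field;
  rewrite gt_eqF.
have t'n0 : 0 < t' / n%:R by rewrite divr_gt0.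
have eta0 : 0 < eta by rewrite divr_gt0 ?mulr_gt0// subr_gt0.
have {}E2 := E2 fb eta Gfb hfb ltac:(lra).
have inf_fb := inf_risk_le P G G_neq0 G_meas G_01 fb Gfb.
have fh_fb := fh_min w fb Gfb.
set V := Var P (fun s => fb s - fstar s) in hbern.
(* Young's inequality with u = sqrt eps sqrt V and v = sqrt (2 t / (eps n)), whose product dominates
   the left side. Submultiplicativity splits off phi (sqrt eps), and the link condition bounds phi
   (sqrt V). *)
have sV : Num.sqrt (2 * t' * V / n%:R) <= phe * (mean P fb - mean P fstar) + cj.
  apply: (@le_trans _ _ (Num.sqrt eps * Num.sqrt V * Num.sqrt (2 * t / (eps *
    n%:R)))).
    have V0 : 0 <= V by apply: Var_ge0; exact: bounded_measB.
    rewrite -sqrtrM ?(ltW eps_gt0)// -[leRHS]sqrtrM;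
      last by rewrite mulr_ge0 ?(ltW eps_gt0).
    apply: ler_wsqrtr.
    have -> : eps * V * (2 * t / (eps * n%:R)) = 2 * t * V / n%:R.
      by field; rewrite !gt_eqF.
    by rewrite ler_pM2r ?invr_gt0// ler_wpM2r// ler_pM2l// ltW.
  have := conjugate_ge (Num.sqrt eps * Num.sqrt V) (Num.sqrt (2 * t / (eps *
    n%:R)))
    (mulr_ge0 (sqrtr_ge0 _) (sqrtr_ge0 _)).
  rewrite hcj lee_fin.
  have := phi_submul _ _ (sqrtr_ge0 eps) (sqrtr_ge0 V).
  have : phe * phi (Num.sqrt V) <= phe * (mean P fb - mean P fstar).
    by rewrite ler_wpM2l// phi_link.
  rewrite -/phe; lra.
have p0 := phe_ge0; have p1 : phe < 1 by exact: phi_eps_lt1.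
move: hbern; rewrite /= emp_meanB meanB// ltr_norml => /andP[b1 b2].
set m := mean P fb - mean P fstar in sV b1 b2.
set em := emp_mean x fb - emp_mean x fstar in b1 b2.
have bm1 : (1 - phe) * m < em + cj + t' / n%:R by lra.
have bm2 : em < (1 + phe) * m + cj + t' / n%:R by lra.
split; last first.
  have : (1 + phe) * m <= (1 + phe) * (inf_risk P G - mean P fstar + eta).
    by rewrite ler_wpM2l ?/m; lra.
  have : (1 + phe) * eta <= 2 * eta by rewrite ler_wpM2r ?(ltW eta0)//; lra.
  rewrite /em in bm2; lra.
have h1 : (1 - phe) * (mean P (fh x) - mean P fstar)
  <= (1 - phe) * dh x + (1 - phe) * m.
  by rewrite -mulrDr ler_wpM2l ?/m; lra.
rewrite /A_const -/phe /em in bm1 *; lra.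
Qed.

(** Empty where [U_bar] is too large, so that every level has probability at most exp(-t)
    unconditionally. *)
Let level_event (i : nat) : set Omega :=
  if `[< (U_bar P X rho G t (delta_ q i) <= (c * delta_ q i)%:E)%E >] then
    [set w | ((2 * (c * delta_ q i))%:E <= emp_sup P G (delta_ q i) (sample X
      w))%E]
  else set0.

Let measurable_level_event i : measurable (level_event i).
Proof.
rewrite /level_event; case: asboolP => // _.
exact: (measurable_emp_sup_event P Pr n_gt0 X G G_neq0 G_meas G_01 G_class _
  (delta_gt0 q q_gt1 i)).
Qed.

Let Pr_level_event i : (Pr (level_event i) <= (expR (- t))%:E)%E.
Proof.
rewrite /level_event; case: asboolP => [h|_];
  last by rewrite measure0 lee_fin expR_ge0.
exact: (emp_sup_tail P Pr n_gt0 X X_iid rho rho_ge0 rho_var G G_neq0 G_meas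
  G_01 G_class
  t t_gt0 _ (delta_gt0 q q_gt1 i)).
Qed.

Let level_bound (i : nat) :
  (U_bar P X rho G t (delta_ q i) <= (c * delta_ q i)%:E)%E ->
  i%:R <= logq q (n%:R / t).
Proof.
have q0 : 0 < q := lt_trans ltr01 q_gt1.
move=> /(U_level_ge P Pr X q q_gt1 rho rho_ge0 G G_neq0 G_meas G_01 t _
  (delta_gt0 q q_gt1 i)) h.
have : t / n%:R <= delta_ q i.
  apply: le_trans h; rewrite ler_peMl ?(ltW tn0)//.
  have : 1 <= q ^+ 3 by rewrite exprn_ege1// ltW.
  lra.
rewrite delta_expR// -[leLHS]lnK ?posrE// ler_expR -[t / _]invf_div lnV ?posrE
  ?divr_gt0//.
by rewrite mulNr lerN2 /logq -ler_pdivlMr ?ln_gt0.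
Qed.

(** For t <= n let L be the base-q logarithm of n / t. At most L + 1 levels count, and two Bernstein
    events cost 3/2 each in units of exp(-t); the total L + 4 is at most 2 (2 + L), which is the
    stated logarithm. For t > n only the failure of [Delta] is charged. *)
Lemma bad_event : exists B : set Omega, [/\ measurable B,
  (Pr B <= (p + 2 * Num.max 0 (logq q (q ^+ 2 * n%:R / t)) * expR (- t))%:E)%E
  & forall w, ~ B w -> excess_bounds w].
Proof.
have [nt|tn] := ltP n%:R t.
  exists (~` Delta); split.
  - exact: measurableC.
  - apply: le_trans Pr_DeltaC _; rewrite lee_fin lerDl mulr_ge0 ?expR_ge0//
      mulr_ge0//.
    by rewrite le_max lexx.
  - by move=> w /contrapT; exact: excess_bounds_large_t.
pose L := logq q (n%:R / t).
have q0 : 0 < q := lt_trans ltr01 q_gt1.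
have lq0 : 0 < ln q by rewrite ln_gt0.
have L0 : 0 <= L.
  by rewrite divr_ge0 ?(ltW lq0)// ln_ge0// ler_pdivlMr// mul1r.
have LE : logq q (q ^+ 2 * n%:R / t) = 2 + L.
  rewrite /L /logq -mulrA lnM ?posrE ?exprn_gt0 ?divr_gt0// lnXn// mulrDl.
  by congr (_ + _); rewrite -[ln q *+ 2]mulr_natl mulfK// gt_eqF.
pose M := Num.truncn L.
have [ML LM] : M%:R <= L /\ L < M.+1%:R by have /andP[] := truncn_itv L0.
(* Bernstein's inequality at a level [t' < t] leaves room for the infimum of the
   risk not being attained; the cost is the factor [expR theta <= 3 / 2]. *)
pose theta := Num.min (t / 2) (ln (3 / 2)).
have ln32 : 0 < ln (3 / 2 : R) by rewrite ln_gt0//; lra.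
have theta0 : 0 < theta by rewrite lt_min ln32 andbT divr_gt0.
have [th1 th2] : theta <= t / 2 /\ theta <= ln (3 / 2) by rewrite !ge_min !lexx
  orbT.
pose t' := t - theta.
have t'0 : 0 < t' by rewrite /t'; lra.
have t't : t' < t by rewrite /t'; lra.
have et' : expR (- t') <= 3 / 2 * expR (- t).
  rewrite /t' opprB expRD ler_wpM2r ?expR_ge0//.
  by rewrite -[leRHS]lnK ?posrE ?ler_expR//; lra.
pose eta := (t - t') / (2 * n%:R).
have eta0 : 0 < eta by rewrite divr_gt0 ?mulr_gt0// subr_gt0.
have [fb Gfb fbE] := inf_risk_adherent P G G_neq0 G_meas G_01 eta eta0.
have bfb : bounded_meas fb by exact: bounded_meas_G G_meas G_01 _ Gfb.
pose h s := fb s - fstar s.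
have bh : bounded_meas h by exact: bounded_measB.
have bNh := bounded_measN h bh.
have h1 s : `|h s| <= 1.
  have /andP[? ?] := G_01 fb Gfb s; have /andP[? ?] := fstar_01 s.
  by rewrite /h ler_norml; apply/andP; split; lra.
have Nh1 s : `|- h s| <= 1 by rewrite normrN.
pose z := Num.sqrt (2 * t' * Var P h / n%:R) + t' / n%:R.
pose Ep := [set w | z <= emp_mean (sample X w) h - mean P h].
pose Em := [set w | z <= emp_mean (sample X w) (fun s =>
  - h s) - mean P (fun s => - h s)].
have PEp : (Pr Ep <= (expR (- t'))%:E)%E.
  exact: (emp_bernstein P Pr n_gt0 X X_iid h t' z bh h1 t'0).
have PEm : (Pr Em <= (expR (- t'))%:E)%E.
  apply: (emp_bernstein P Pr n_gt0 X X_iid _ t' z bNh Nh1 t'0).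
  by rewrite VarN.
have mE (f : S -> R) : bounded_meas f ->
    measurable [set w | z <= emp_mean (sample X w) f - mean P f].
  move=> [mf _].
  have me : measurable_fun [set: Omega] (fun w =>
    emp_mean (sample X w) f - mean P f).
    apply: measurable_funB; last exact: measurable_cst.
    apply: measurable_funM; first exact: measurable_cst.
    apply: measurable_sum => i.
    apply: (measurableT_comp mf).
    exact: (measurableT_comp (measurable_tnth i) (measurable_sample Pr X)).
  rewrite (_ : [set w | _] = (fun w => emp_mean (sample X w) f - mean P f)
    @^-1` `[z, +oo[).
    by rewrite -[X in measurable X]setTI; apply: me => //;
      exact: measurable_itv.
  by apply/seteqP; split => w /=; rewrite in_itv/= andbT.
have mEp : measurable Ep by exact: mE.
have mEm : measurable Em by exact: mE.
pose Lv := \big[setU/set0]_(i < M.+1) level_event i.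
have mLv : measurable Lv by exact: bigsetU_measurable.
have PLv : (Pr Lv <= (M.+1%:R * expR (- t))%:E)%E.
  apply: le_trans (Boole_inequality Pr (fun i _ => measurable_level_event i)) _.
  apply: (@le_trans _ _ (\sum_(i < M.+1) (expR (- t))%:E)%E);
    first by apply: lee_sum => i _; exact: Pr_level_event.
  by rewrite sumEFin sumr_const card_ord mulr_natl.
have mC : measurable (~` Delta) by exact: measurableC.
have mpm : measurable (Ep `|` Em) by exact: measurableU.
have mLpm : measurable (Lv `|` (Ep `|` Em)) by exact: measurableU.
exists (~` Delta `|` (Lv `|` (Ep `|` Em))); split.
- exact: measurableU.
- apply: (@le_trans _ _ (p%:E + ((M.+1%:R * expR (- t))%:E + ((expR (- t'))%:E
    + (expR (- t'))%:E)))%E).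
    apply: le_trans (measureU2 _ mC mLpm) _; apply: leeD => //.
    apply: le_trans (measureU2 _ mLv mpm) _; apply: leeD => //.
    by apply: le_trans (measureU2 _ mEp mEm) _; exact: leeD.
  rewrite -!EFinD lee_fin lerD2l LE max_r; last by lra.
  have e0 := expR_gt0 (- t).
  have : (M.+1%:R + 3) * expR (- t) <= 2 * (2 + L) * expR (- t).
    by rewrite ler_wpM2r ?(ltW e0)// -natr1; lra.
  lra.
move=> w /not_orP[/contrapT Dw /not_orP[Lw /not_orP[/negP Epw /negP Emw]]].
apply: (excess_bounds_main w fb t' t'0 t't Gfb (ltW fbE) Dw).
- move=> i Ui; rewrite ltNge; apply/negP => Ei; apply: Lw.
  have iM : (i < M.+1)%N.
    by rewrite -(ltr_nat R) (le_lt_trans _ LM)//; exact: level_bound.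
  rewrite /Lv -bigcup_mkord; exists i => //; rewrite /level_event.
  by case: asboolP.
- rewrite /= -/h -/z; move: Epw Emw.
  rewrite meanN// (_ : emp_mean _ (fun s => - h s) = - emp_mean (sample X w)
    h); last first.
    by rewrite /emp_mean sumrN mulrN.
  rewrite -!ltNge => Epw Emw; rewrite ltr_norml; apply/andP; split => //.
  by move: Emw; lra.
Qed.

End bad_event.

Theorem theorem6 (R : realType)
    (d : measure_display) (S : measurableType d) (P : probability S R)
    (d' : measure_display) (Omega : measurableType d')
    (Pr : probability Omega R)
    (n : nat) (n_gt0 : (0 < n)%N)
    (X : 'I_n -> {RV Pr >-> S}) (X_iid : iid P X)
    (q : R) (q_gt1 : 1 < q)
    (rho : (S -> R) -> (S -> R) -> R)
    (rho_ge0 : forall f g : S -> R,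
      f \in Lfun P 2%:E -> g \in Lfun P 2%:E -> 0 <= rho f g)
    (rho_var : forall f g : S -> R,
      f \in Lfun P 2%:E -> g \in Lfun P 2%:E ->
      mean P (fun x => (f x - g x) ^+ 2) - mean P (fun x => f x - g x) ^+ 2
        <= rho f g ^+ 2)
    (F : set (S -> R))
    (F_meas : forall f, F f -> measurable_fun [set: S] f)
    (F_01 : forall f, F f -> forall x, 0 <= f x <= 1)
    (F_ : nat -> set (S -> R))
    (F_sub : forall k, (1 <= k)%N -> F_ k `<=` F)
    (F_sup_meas : forall k, (1 <= k)%N -> forall delta : R, 0 < delta ->
      measurable_class P n (diff_class (min_set P (F_ k) delta)))
    (fstar : S -> R) (fstar_in : F fstar)
    (fstar_min : forall f, F f -> mean P fstar <= mean P f)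
    (fhat : nat -> n.-tuple S -> (S -> R))
    (fhat_in : forall k, (1 <= k)%N -> forall w, F_ k (fhat k (sample X w)))
    (fhat_min : forall k, (1 <= k)%N -> forall w f, F_ k f ->
      emp_mean (sample X w) (fhat k (sample X w)) <= emp_mean (sample X w) f)
    (phi : R -> R)
    (phi_convex : convex_function (`[0, +oo[ : set R^o) phi)
    (phi_nondecr : forall u v : R, 0 <= u -> u <= v -> phi u <= phi v)
    (phi_0 : phi 0 = 0)
    (phi_submul : forall u v : R, 0 <= u -> 0 <= v ->
      phi (u * v) <= phi u * phi v)
    (phi_link : forall f, F f ->
      phi (Num.sqrt (Var P (fun x => f x - fstar x)))
        <= mean P f - mean P fstar)
    (eps : R) (eps_gt0 : 0 < eps) (phi_eps_lt1 : phi (Num.sqrt eps) < 1)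
    (t : nat -> R) (t_gt0 : forall k, (1 <= k)%N -> 0 < t k)
    (dhat : nat -> n.-tuple S -> R)
    (dhat_meas : forall k, (1 <= k)%N -> measurable_fun [set: n.-tuple S] (dhat k))
    (dtilde : nat -> R) (p : nat -> R)
    (dhat_dtilde : forall k, (1 <= k)%N ->
      ((1 - p k)%:E <=
        Pr [set w | delta_bar P X rho q (F_ k) (t k)
                      <= (dhat k (sample X w))%:E <= (dtilde k)%:E])%E)
    (khat : n.-tuple S -> nat)
    (khat_ge1 : forall w, (1 <= khat (sample X w))%N)
    (khat_min : forall w k, (1 <= k)%N ->
      let x := sample X w in
      ((emp_mean x (fhat (khat x) x))%:E
         + pi_hat phi eps n (t (khat x)) (dhat (khat x) x)
       <= (emp_mean x (fhat k x))%:E + pi_hat phi eps n (t k) (dhat k x))%E)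
    (risk_meas : measurable_fun [set: n.-tuple S]
      (fun x : n.-tuple S => excess_risk P F (fhat (khat x) x))) :
  (Pr [set w |
        (C_const phi eps)%:E *
          ereal_inf [set (inf_risk P (F_ k) - inf_risk P F)%:E
                           + pi_tilde phi eps n (t k) (dtilde k)
                    | k in [set k : nat | (1 <= k)%N]]
        <= (excess_risk P F
              (fhat (khat (sample X w)) (sample X w)))%:E]
   <= \sum_(1 <= k <oo)
        (p k + 2 * Num.max 0 (logq q (q ^+ 2 * n%:R / t k))
                 * expR (- t k))%:E)%E.
Proof.
(* Some outcome is needed to see that each [F_ k] is nonempty: it contains the empirical minimizer
   at that outcome. *)
have w0 : Omega := point.
set phe := phi (Num.sqrt eps).
have phe0 : 0 <= phe by rewrite -phi_0; apply: phi_nondecr => //;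
  exact: sqrtr_ge0.
have phe1 : phe < 1 by [].
have infF : inf_risk P F = mean P fstar.
  apply/eqP; rewrite eq_le; apply/andP; split.
    apply: ge_inf; last by exists fstar.
    by exists (mean P fstar) => _ [f Ff <-]; exact: fstar_min.
  apply: lb_le_inf; first by exists (mean P fstar), fstar.
  by move=> _ [f Ff <-]; exact: fstar_min.
pose bnd k : R := p k + 2 * Num.max 0 (logq q (q ^+ 2 * n%:R / t k)) * expR (-
  t k).
have bad k : exists B : set Omega, (1 <= k)%N -> [/\ measurable B,
    (Pr B <= (bnd k)%:E)%E & forall w, ~ B w ->
    excess_bounds P Pr X (F_ k) (t k) fstar phi eps (fhat k) (dhat k) (dtilde
      k) w].
  case: k => [|k]; first by exists set0.
  have k1 : (1 <= k.+1)%N by [].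
  have [B HB] := bad_event P Pr n_gt0 X X_iid q q_gt1 rho rho_ge0 rho_var (F_
    k.+1)
    (ex_intro _ _ (fhat_in k.+1 k1 w0))
    (fun f Ff => F_meas f (F_sub k.+1 k1 f Ff)) (fun f Ff =>
      F_01 f (F_sub k.+1 k1 f Ff))
    (F_sup_meas k.+1 k1) (t k.+1) (t_gt0 k.+1 k1) fstar (F_meas _ fstar_in)
    (F_01 _ fstar_in) (fun f Ff => fstar_min f (F_sub k.+1 k1 f Ff))
    phi phi_nondecr phi_0 phi_submul (fun f Ff =>
      phi_link f (F_sub k.+1 k1 f Ff))
    eps eps_gt0 phi_eps_lt1 (fhat k.+1) (fhat_in k.+1 k1) (fhat_min k.+1 k1)
    (dhat k.+1) (dhat_meas k.+1 k1) (dtilde k.+1) (p k.+1) (dhat_dtilde k.+1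
      k1).
  by exists B.
have [B HB] := choice bad.
(* Indices start at 1; the empty set at 0 adds nothing to the union or to the series. *)
pose B' k := if (1 <= k)%N then B k else set0.
have mB' k : measurable (B' k).
  by rewrite /B'; case: ifPn => // k1; have [] := HB k k1.
set A := [set w | _].
have mA : measurable A.
  have mr : measurable_fun [set: Omega] (fun w => (excess_risk P F
      (fhat (khat (sample X w)) (sample X w)))%:E).
    apply/measurable_EFinP.
    exact: (measurableT_comp risk_meas (measurable_sample Pr X)).
  rewrite /A; set a := (_ * _)%E.
  rewrite (_ : [set w | _] = (fun w => (excess_risk P F
      (fhat (khat (sample X w)) (sample X w)))%:E) @^-1` `[a, +oo%E]).
    by rewrite -[X in measurable X]setTI; apply: mr => //;
      exact: emeasurable_itv.
  by apply/seteqP; split => w /=; rewrite in_itv/= leey andbT.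
have AB : A `<=` \bigcup_k B' k.
  move=> w Aw; apply: contrapT => nB.
  have good k : (1 <= k)%N ->
      excess_bounds P Pr X (F_ k) (t k) fstar phi eps (fhat k) (dhat k) (dtilde
        k) w.
    move=> k1; have [_ _] := HB k k1; apply => Bw; apply: nB.
    by exists k => //; rewrite /B' k1.
  move: Aw; rewrite /A /=; set x := sample X w in good *.
  set kh := khat x; have kh1 : (1 <= kh)%N by exact: khat_ge1.
  apply/negP; rewrite -ltNge.
  pose v k := Num.sqrt (2 * t k / (eps * n%:R)).
  have conjNy k : conjugate phi (v k) != -oo%E.
    rewrite -ltNye; apply: lt_le_trans (conjugate_ge phi 0 (v k) (lexx _)).
    exact: ltNyr.
  have C0 : 0 < C_const phi eps by rewrite divr_gt0 ?subr_gt0//; rewrite -/phe;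
    lra.
  have khm k : (1 <= k)%N -> _ := khat_min w k.
  rewrite -/x /= -/kh in khm.
  pose s := t kh / n%:R.
  have s0 : 0 < s by rewrite divr_gt0 ?t_gt0// ltr0n.
  pose Ex := mean P (fhat kh x) - mean P fstar.
  have A0 : 0 <= A_const phi eps by rewrite /A_const -/phe; lra.
  have p1 : 0 < 1 + phe by lra.
  (* The chain is: lower bound of [excess_bounds] at the selected index, minimality of that index
     against [k], upper bound of [excess_bounds] at [k]. Dividing by 1 + phe turns the result into
     [pi_tilde]. *)
  have key k : (1 <= k)%N -> ((((1 - phe) * Ex + s) / (1 + phe))%:E <=
      (inf_risk P (F_ k) - inf_risk P F)%:E + pi_tilde phi eps n (t k) (dtilde
        k))%E.
    move=> k1; rewrite /pi_tilde -/phe -/(v k).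
    (* An infinite conjugate at [k] makes the right side infinite. If it is finite at [k],
       minimality makes it finite at the selected index too. *)
    case ck : (conjugate phi (v k)) (conjNy k) => [c| |]// _; last first.
      by rewrite gt0_muley ?lte_fin ?divr_gt0// addey// leey.
    have := khm k k1; rewrite /pi_hat -!/(v _) ck.
    case ckh : (conjugate phi (v kh)) (conjNy kh) => [c'| |]// _.
    rewrite -!EFinD lee_fin => hk.
    have [_ /(_ _ ckh) [C1 _]] := good kh kh1.
    have [dd /(_ _ ck) [_ C2]] := good k k1.
    rewrite -/x -/phe in C1 C2 dd; rewrite -/Ex -/s in C1.
    have Ad : A_const phi eps * dhat k x <= A_const phi eps * dtilde k by
      rewrite ler_wpM2l.
    rewrite -?EFinM -?EFinD lee_fin ler_pdivrMr// infF.
    have -> : (inf_risk P (F_ k) - mean P fstar + (A_const phi eps / (1 + phe)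
      * dtilde k
        + 2 / (1 + phe) * c + 2 / (1 + phe) * (t k / n%:R))) * (1 + phe) =
      (1 + phe) * (inf_risk P (F_ k) - mean P fstar) + A_const phi eps * dtilde
        k
        + 2 * c + 2 * (t k / n%:R).
      by field; rewrite !gt_eqF// ltr0n.
    rewrite -/s in hk; lra.
  rewrite /excess_risk infF -/Ex.
  (* [C_const] cancels the factor (1 - phe) / (1 + phe) and leaves the positive surplus s / (1 -
     phe), hence strictness. *)
  apply: (@lt_le_trans _ _ ((C_const phi eps)%:E * (((1 - phe) * Ex + s) / (1 +
    phe))%:E)%E).
    rewrite -EFinM lte_fin /C_const -/phe.
    have -> : (1 + phe) / (1 - phe) * (((1 - phe) * Ex + s) / (1 + phe)) = Ex +
      s / (1 - phe).
      by field; rewrite !gt_eqF// subr_gt0.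
    by rewrite ltrDl divr_gt0// subr_gt0.
  rewrite lee_pmul2l//; apply: le_ereal_inf_tmp => _ [k k1 <-].
  by rewrite -infF; exact: key.
apply: le_trans (measure_sigma_subadditive Pr mB' mA AB) _.
rewrite nneseries_recl// {1}/B' measure0 add0e.
rewrite eseries_cond [leRHS]eseries_cond; apply: lee_nneseries => // k k1.
by move: k1; rewrite /= /B' => k1; rewrite k1; have [_] := HB k k1.
Qed.
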